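(* Let $\epsilon\in(0,\tfrac14)$ be fixed and let $H$ be a fixed graph with vertex set $[k]$. Assume $\mathbf n=\mathbf n(n)\in\mathbb N^k$ and $p=p(n)\in(0,1)$ are such that, as $n\to\infty$, $$\|\mathbf n\|\to\infty,\qquad p\ge\|\mathbf n\|^{-\frac14+\epsilon},\qquad 1-p=\|\mathbf n\|^{-o(1)}.$$ Let $G=G_H(\mathbf n)$. Then, with high probability, $$\chi(G_p)=(1+o(1))\frac{\log\frac1{1-p}}{2\log(p\,|V(G)|)}\,\chi(G).$$
   Context: For a graph $H$ on $[k]$ and $\mathbf n=(n_1,\dots,n_k)^T$, the blow-up graph $G_H(\mathbf n)$ is obtained by replacing each vertex $i\in[k]$ by a clique $K_{n_i}$ and joining every vertex of the $i$-th clique to every vertex of the $j$-th clique ($i\neq j$) exactly when $ij$ is an edge of $H$; so $|V(G_H(\mathbf n))|=\|\mathbf n\|=n_1+\dots+n_k$. For a graph $G$, the percolated random graph $G_p$ keeps each edge of $G$ independently with probability $p$. $\chi$ is the chromatic number, $\log$ the natural logarithm. ''With high probability'' means with probability tending to $1$ as $n\to\infty$; $X=(1+o(1))Y$ whp means for every fixed $\delta>0$, $(1-\delta)Y\le X\le(1+\delta)Y$ with probability tending to $1$. *)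

(* Defs.v *)
From HB Require Import structures.
From mathcomp Require Import all_boot all_order all_algebra.
From mathcomp Require Import all_classical all_reals all_analysis.
Set Implicit Arguments.
Unset Strict Implicit.
Unset Printing Implicit Defensive.
Import Order.TTheory GRing.Theory Num.Theory.
Local Open Scope ring_scope.

Record sgraph (V : finType) := SGraph {
  adj :> rel V;
  adj_sym : symmetric adj;
  adj_irr : irreflexive adj }.

Section Graph.
Variables (V : finType) (G : sgraph V).

Definition edges : {set {set V}} :=
  [set e | [exists x, exists y, G x y && (e == [set x; y]%SET)]]%SET.

Definition colorable (m : nat) : bool :=
  [exists c : {ffun V -> 'I_m}, forall x, forall y, G x y ==> (c x != c y)].

Lemma ex_colorable : exists m, colorable m.
Proof.
exists #|V|; apply/existsP; exists [ffun x => enum_rank x].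
apply/forallP => x; apply/forallP => y; apply/implyP => Gxy; rewrite !ffunE.
apply: contraTneq Gxy => /enum_rank_inj ->.
by rewrite adj_irr.
Qed.

Definition chi : nat := ex_minn ex_colorable.

Definition keep_adj (F : {set {set V}}) : rel V :=
  fun x y => G x y && ([set x; y]%SET \in F).

Lemma keep_sym (F : {set {set V}}) : symmetric (keep_adj F).
Proof. by move=> x y; rewrite /keep_adj adj_sym finset.setUC. Qed.

Lemma keep_irr (F : {set {set V}}) : irreflexive (keep_adj F).
Proof. by move=> x; rewrite /keep_adj adj_irr. Qed.

Definition keep (F : {set {set V}}) : sgraph V :=
  SGraph (keep_sym F) (keep_irr F).

(* The probability that G_p has property A: the set F of kept edges equals a
   given subset of the edge set with probability p^|F| (1-p)^(|E(G)| - |F|). *)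
Definition percolation_prob (R : realType) (p : R) (A : sgraph V -> bool) : R :=
  \sum_(F in powerset edges | A (keep F))
    p ^+ #|F| * (1 - p) ^+ #|edges :\: F|.

End Graph.

Definition blowup_vertex (k : nat) (n : 'I_k -> nat) : finType :=
  {i : 'I_k & 'I_(n i)}.

Section Blowup.
Variables (k : nat) (H : sgraph 'I_k) (n : 'I_k -> nat).

Definition blowup_adj : rel (blowup_vertex n) :=
  fun u v => (u != v) && ((tag u == tag v) || H (tag u) (tag v)).

Lemma blowup_sym : symmetric blowup_adj.
Proof.
by move=> u v; rewrite /blowup_adj eq_sym [tag u == _]eq_sym adj_sym.
Qed.

Lemma blowup_irr : irreflexive blowup_adj.
Proof. by move=> u; rewrite /blowup_adj eqxx. Qed.

Definition blowup : sgraph (blowup_vertex n) := SGraph blowup_sym blowup_irr.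

End Blowup.

Definition l1norm (k : nat) (n : 'I_k -> nat) : nat := (\sum_(i < k) n i)%N.

(* Main.v *)
(* Write N = |V(G)|, q = 1 - p, alpha = 2 log(pN) / log(1/q), so that the claim
   is chi(G_p) = (1 + o(1)) chi(G) / alpha.

   Lower bound, for any G.  Let d = (1 + o(1)) alpha.  By a first moment
   computation, whp no nonempty T such that G[T] has minimum degree at least d
   is independent in G_p.  Hence, for S independent in G_p, every subgraph of
   G[S] has a vertex of degree less than d, so G[S] is d-colourable by
   degeneracy and chi(G) <= d chi(G_p).

   Upper bound.  Let s = (1 - o(1)) alpha and m = N^(1 - gamma) with gamma small.
   Janson's inequality, with failure probability exp(- c m^2 / s^4 ...) << 2^-N
   thanks to p >= N^(-1/4 + eps), shows that whp every clique of G on m vertices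
   contains an s-set independent in G_p.  Also whp every set of at most m
   vertices spans in G_p a graph of degeneracy O(pm), and pm = o(N / alpha).
   Removing independent s-sets greedily, every clique U of G can thus be coloured
   in G_p with |U| / s + O(pm) colours.  Finally the colour classes of an optimal
   colouring of G are grouped by the set of parts that they meet: there are at
   most 2^k groups, and within a group distinct parts are not adjacent, so that
   they can use the same colours. *)

Require Import Defs.
From HB Require Import structures.
From mathcomp Require Import all_boot all_order all_algebra.
From mathcomp Require Import reals sequences exp.
From mathcomp Require Import zify ring lra.
Set Implicit Arguments.
Unset Strict Implicit.
Unset Printing Implicit Defensive.
Import Order.TTheory GRing.Theory Num.Theory.

(** * Colourings *)

Section GraphColoring.
Variable V : finType.
Implicit Types (G : sgraph V) (S T U W A : {set V}) (F : {set {set V}}).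

Definition inner_edges G T : {set {set V}} := [set e in edges G | e \subset T].

Definition deg_in G T x : nat := #|[set y in T | G x y]|.

Definition independent G T : bool := [forall x in T, forall y in T, ~~ G x y].

Definition is_clique G T : bool :=
  [forall x in T, forall y in T, (x != y) ==> G x y].

(** Colours are plain naturals, constrained only on [S], so that palettes can be shifted and glued
    over subsets without changing types. *)
Definition colorable_on G S (m : nat) : Prop :=
  exists2 c : V -> nat, {in S, forall x, c x < m} &
    {in S &, forall x y, G x y -> c x != c y}.

Lemma independentP G T : reflect {in T &, forall x y, ~~ G x y} (independent G T).
Proof.
apply: (iffP forall_inP) => [ind x y xT yT|ind x xT].
  by have /forall_inP := ind x xT; apply.
by apply/forall_inP => y; apply: ind.
Qed.

Lemma is_cliqueP G T :
  reflect {in T &, forall x y, x != y -> G x y} (is_clique G T).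
Proof.
apply: (iffP forall_inP) => [ind x y xT yT|ind x xT].
  by have /forall_inP/(_ y yT)/implyP := ind x xT; apply.
by apply/forall_inP => y yT; apply/implyP; apply: ind.
Qed.

Lemma mem_edges G x y : ([set x; y] \in edges G) = G x y.
Proof.
rewrite inE; apply/existsP/idP => [[x' /existsP[y' /andP[Gxy /eqP E]]]|Gxy].
  have xE : x \in [set x'; y'] by rewrite -E set21.
  have yE : y \in [set x'; y'] by rewrite -E set22.
  have x'E : x' \in [set x; y] by rewrite E set21.
  have y'E : y' \in [set x; y] by rewrite E set22.
  move: xE yE x'E y'E; rewrite !inE.
  have nxy : x' != y' by apply: contraTneq Gxy => ->; rewrite adj_irr.
  case/orP => /eqP->; case/orP => /eqP-> //; first by rewrite orbb [y' == _]eq_sym (negPf nxy).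
    by rewrite adj_sym.
  by rewrite orbb (negPf nxy).
by exists x; apply/existsP; exists y; rewrite Gxy eqxx.
Qed.

Lemma edgesP G e :
  reflect (exists x y, G x y /\ e = [set x; y]) (e \in edges G).
Proof.
rewrite inE; apply: (iffP existsP) => [[x /existsP[y /andP[Gxy /eqP->]]]|].
  by exists x, y.
by case=> x [y [Gxy ->]]; exists x; apply/existsP; exists y; rewrite Gxy eqxx.
Qed.

Lemma edges_keep G F : F \subset edges G -> edges (keep G F) = F.
Proof.
move=> sF; apply/setP => e; apply/edgesP/idP => [[x [y [/andP[_ eF] ->]]] //|eF].
have /edgesP[x [y [Gxy E]]] := subsetP sF e eF.
by exists x, y; split=> //; rewrite /= /keep_adj Gxy -E.
Qed.

Lemma mem_inner_edges G T e :
  (e \in inner_edges G T) = (e \in edges G) && (e \subset T).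
Proof. by rewrite in_set. Qed.

Lemma inner_edges_keep G F T : F \subset edges G ->
  inner_edges (keep G F) T = F :&: inner_edges G T.
Proof.
move=> sF; apply/setP => e; rewrite in_setI !mem_inner_edges edges_keep //.
by case eF: (e \in F); rewrite //= (subsetP sF).
Qed.

Lemma inner_edges0_independent G T : (inner_edges G T == set0) = independent G T.
Proof.
apply/eqP/independentP => [E0 x y xT yT|ind].
  apply/negP => Gxy; have : [set x; y] \in inner_edges G T.
    by rewrite inE mem_edges Gxy subUset !sub1set xT.
  by rewrite E0 in_set0.
apply/setP => e; rewrite in_set0; apply/negP; rewrite inE => /andP[/edgesP].
by case=> x [y [Gxy ->]]; rewrite subUset !sub1set => /andP[xT yT]; have /negP := ind x y xT yT.
Qed.

Lemma independent_keep G F T : F \subset edges G ->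
  independent (keep G F) T = (F :&: inner_edges G T == set0).
Proof. by move=> sF; rewrite -inner_edges_keep // inner_edges0_independent. Qed.

(** Double counting: an edge inside [T] arises from at most two ordered pairs of adjacent
    vertices. *)
Lemma sum_deg_in_le G T : \sum_(x in T) deg_in G T x <= 2 * #|inner_edges G T|.
Proof.
pose Pr := [set xy : V * V | [&& xy.1 \in T, xy.2 \in T & G xy.1 xy.2]].
have -> : \sum_(x in T) deg_in G T x = \sum_(xy in Pr) 1.
  under eq_bigr do rewrite /deg_in -sum1_card.
  rewrite pair_big_dep; apply: eq_bigl => -[x y] /=.
  by rewrite !inE.
rewrite (partition_big (fun xy : V * V => [set xy.1; xy.2]) (mem (inner_edges G T))) /=.
  rewrite mulnC -sum_nat_const; apply: leq_sum => e.
  rewrite inE => /andP[/edgesP[x [y [Gxy ->]]] _].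
  rewrite sum1dep_card; apply: (@leq_trans #|[set (x, y); (y, x)]|); last first.
    by rewrite cards2; case: (_ != _).
  apply/subset_leq_card/subsetP => -[x' y']; rewrite !inE /= => /andP[/and3P[_ _ G']].
  rewrite !xpair_eqE => /eqP E.
  have nxy : x' != y' by apply: contraTneq G' => ->; rewrite adj_irr.
  have : x' \in [set x; y] by rewrite -E set21.
  have : y' \in [set x; y] by rewrite -E set22.
  rewrite !inE => /orP[]/eqP y'E /orP[]/eqP x'E; move: nxy;
    by rewrite x'E y'E ?eqxx ?orbT.
move=> [x y]; rewrite inE /= => /and3P[xT yT Gxy].
by rewrite mem_inner_edges mem_edges Gxy subUset !sub1set xT.
Qed.

Lemma inner_edges_sub_draws G T :
  inner_edges G T \subset [set A : {set V} | A \subset T & #|A| == 2].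
Proof.
apply/subsetP => e; rewrite !inE => /andP[/existsP[x /existsP[y /andP[Gxy /eqP->]]] ->].
by rewrite /= cards2 (_ : x != y) //; apply: contraTneq Gxy => ->; rewrite adj_irr.
Qed.

Lemma card_inner_edges_le G T : #|inner_edges G T| <= 'C(#|T|, 2).
Proof. by rewrite -cards_draws; apply: subset_leq_card; apply: inner_edges_sub_draws. Qed.

Lemma card_inner_edges_clique G T : is_clique G T -> #|inner_edges G T| = 'C(#|T|, 2).
Proof.
move/is_cliqueP => cT; rewrite -cards_draws; apply: eq_card => A.
apply/idP/idP; first exact: (subsetP (inner_edges_sub_draws G T)).
rewrite inE => /andP[sAT /cards2P[x [y [nxy E]]]].
rewrite E subUset !sub1set in sAT *; case/andP: sAT => xT yT.
by rewrite inE mem_edges cT // subUset !sub1set xT.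
Qed.

Lemma is_cliqueS G S T : S \subset T -> is_clique G T -> is_clique G S.
Proof.
move=> sST /is_cliqueP cT; apply/is_cliqueP => x y xS yS.
by apply: cT; apply: (subsetP sST).
Qed.

Lemma inner_edgesI G S T :
  inner_edges G S :&: inner_edges G T = inner_edges G (S :&: T).
Proof.
by apply/setP => e; rewrite in_setI !in_set subsetI; case: [exists _, _].
Qed.

Lemma colorable_onS G S T m m' :
  S \subset T -> m <= m' -> colorable_on G T m -> colorable_on G S m'.
Proof.
move=> /subsetP sST mm' [c c1 c2]; exists c => [x /sST/c1 /leq_trans->//|x y /sST xT /sST].
exact: c2.
Qed.

Lemma colorable_onU G S T m m' :
  colorable_on G S m -> colorable_on G T m' -> colorable_on G (S :|: T) (m + m').
Proof.
move=> [c c1 c2] [c' c1' c2'].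
exists (fun x => if x \in S then c x else m + c' x) => [x|x y]; rewrite !inE.
  case: ifP => xS /= => [_|xT]; first by rewrite ltn_addr ?c1.
  by rewrite ltn_add2l c1'.
case: ifP => xS; case: ifP => yS /= xT yT; first exact: c2.
- by move=> _; rewrite ltn_eqF // ltn_addr ?c1.
- by move=> _; rewrite gtn_eqF // ltn_addr ?c1.
- by rewrite eqn_add2l; apply: c2'.
Qed.

Lemma colorable_on_bigcup G (I : finType) (S : I -> {set V}) (m : I -> nat) :
  (forall i, colorable_on G (S i) (m i)) ->
  colorable_on G (\bigcup_i S i) (\sum_i m i).
Proof.
move=> cS; elim/big_rec2: _ => [|i M U _ cU]; last exact: colorable_onU.
by exists (fun=> 0) => x; rewrite inE.
Qed.

(** No edge joins distinct fibres of [f], so all fibres can reuse the same [m] colours. *)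
Lemma colorable_on_components G S (I : finType) (f : V -> I) m :
  (forall i, colorable_on G [set x in S | f x == i] m) ->
  {in S &, forall x y, G x y -> f x = f y} ->
  colorable_on G S m.
Proof.
move=> /fin_all_exists2[c c1 c2] fE.
exists (fun x => c (f x) x) => [x xS|x y xS yS Gxy].
  by apply: c1; rewrite inE xS /=.
by rewrite (fE x y) //; apply: c2 => //; rewrite inE ?xS ?yS /= ?(fE x y).
Qed.

Lemma colorable_on_independent G T : independent G T -> colorable_on G T 1.
Proof.
move/independentP => ind; exists (fun=> 0) => // x y xT yT Gxy.
by move: (ind x y xT yT); rewrite Gxy.
Qed.

Lemma chi_leP G m : colorable_on G [set: V] m -> chi G <= m.
Proof.
case=> c c1 c2; rewrite /chi; case: ex_minnP => M _; apply.
have cm x : c x < m by apply: c1.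
apply/existsP; exists [ffun x => Ordinal (cm x)].
apply/forallP => x; apply/forallP => y; apply/implyP => Gxy; rewrite !ffunE.
by rewrite -val_eqE /= c2.
Qed.

Lemma chiP G : exists c : V -> 'I_(chi G), forall x y, G x y -> c x != c y.
Proof.
rewrite /chi; case: ex_minnP => M /existsP[c cP] _; exists c => x y.
by move/forallP/(_ x)/forallP/(_ y)/implyP: cP; apply.
Qed.

(** Induction on the size of [S]: a vertex of degree less than [d] is set aside, the rest is
    coloured, and the vertex takes one of the [d] colours missing at its neighbours. *)
Lemma degenerate_colorable G S d :
  (forall T, T \subset S -> T != set0 -> exists2 x, x \in T & deg_in G T x < d) ->
  colorable_on G S d.
Proof.
have [n] := ubnP #|S|; elim: n S => // n IHn S.
have [->|nS] := eqVneq S set0; first by exists (fun=> 0) => x; rewrite inE.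
rewrite ltnS => leSn deg.
have [x xS degx] := deg S (subxx S) nS.
have [|T sT|c c1 c2] := IHn (S :\ x).
- by rewrite (cardsD1 x) xS in leSn.
- by apply: deg; apply: subset_trans sT (subD1set _ _).
pose used := [seq c y | y <- enum [set y in S | G x y]].
have /allPn[a] : ~~ all (mem used) (iota 0 d).
  apply/negP => /allP sub; have := uniq_leq_size (iota_uniq 0 d) sub.
  by rewrite size_iota size_map -cardE leqNgt degx.
rewrite mem_iota /= add0n => ad aN.
have aE y : y \in S -> G x y -> a != c y.
  move=> yS Gxy; apply: contraNneq aN => ->.
  by apply: map_f; rewrite mem_enum inE yS.
exists (fun z => if z == x then a else c z) => [z zS|y z yS zS].
  by case: eqP => // /eqP nz; apply: c1; rewrite !inE nz.
case: (eqVneq y x) => [->|ny]; case: (eqVneq z x) => [->|nz].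
- by rewrite adj_irr.
- exact: aE.
- by rewrite adj_sym eq_sym; apply: aE.
- by apply: c2; rewrite !inE ?ny ?nz.
Qed.

(** A colour class of the percolated graph is independent there, so each of its nonempty subsets has
    a vertex of [G]-degree less than [d]; by degeneracy, [d] colours suffice for the class in
    [G]. *)
Lemma chi_le_keepM G F d :
  (forall T, T != set0 -> {in T, forall x, d <= deg_in G T x} ->
    ~~ independent (keep G F) T) ->
  chi G <= chi (keep G F) * d.
Proof.
move=> noT; have [c cP] := chiP (keep G F).
have -> : chi (keep G F) * d = \sum_(a < chi (keep G F)) d.
  by rewrite sum_nat_const card_ord.
apply: chi_leP; apply: (@colorable_onS _ _ (\bigcup_a [set x | c x == a])) (leqnn _) _.
  by apply/subsetP => x _; apply/bigcupP; exists (c x); rewrite ?inE.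
apply: colorable_on_bigcup => a; apply: degenerate_colorable => T sT nT.
have : ~~ [forall x in T, d <= deg_in G T x].
  apply/negP => /forall_inP dT; have /negP := noT T nT dT; apply.
  apply/independentP => x y xT yT; apply/negP => /cP.
  have := subsetP sT x xT; have := subsetP sT y yT; rewrite !inE.
  by move=> /eqP-> /eqP->; rewrite eqxx.
by rewrite negb_forall_in => /exists_inP[x xT]; rewrite -ltnNge; exists x.
Qed.

(** While more than [m] vertices remain, an independent [s]-set is removed at the price of one
    colour, at most [#|U| %/ s] times; the remaining small set costs [D] colours. *)
Lemma greedy_colorable G s D m U : 0 < s ->
  (forall W, W \subset U -> m <= #|W| ->
    exists A, [/\ A \subset W, #|A| = s & independent G A]) ->
  (forall W, W \subset U -> #|W| <= m -> colorable_on G W D) ->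
  colorable_on G U (#|U| %/ s + D).
Proof.
move=> s0; have [n] := ubnP #|U|; elim: n U => // n IHn U.
rewrite ltnS => leUn big small.
have [leUm|ltmU] := leqP #|U| m.
  by apply: colorable_onS (small U _ leUm); rewrite ?leq_addl.
have [A [sAU cA indA]] := big U (subxx U) (ltnW ltmU).
have cU : #|U| = s + #|U :\: A| by rewrite -cA -(cardsID A U) (setIidPr sAU).
have -> : #|U| %/ s + D = 1 + (#|U :\: A| %/ s + D).
  by rewrite cU divnDl // divnn s0 addnA.
apply: (@colorable_onS _ _ (A :|: (U :\: A))) (leqnn _) _.
  by rewrite setDE setUIr setUCr setIT subsetUr.
apply: colorable_onU; first exact: colorable_on_independent.
apply: IHn => [|W sW|W sW].
- by move: leUn; rewrite cU; lia.
- by apply: big; apply: subset_trans sW (subsetDl _ _).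
- by apply: small; apply: subset_trans sW (subsetDl _ _).
Qed.

End GraphColoring.

(** * Colourings of the blow-up and of its percolation *)

Section BlowupColoring.
Variables (k : nat) (H : sgraph 'I_k) (n : 'I_k -> nat).
Let G := blowup H n.

(** Each part is a clique and needs as many colours as it has vertices. This makes small multiples
    of N negligible against [chi G]. *)
Lemma l1norm_le_chi : l1norm n <= k * chi G.
Proof.
have [c cP] := chiP G.
have -> : k * chi G = \sum_(i < k) chi G by rewrite sum_nat_const card_ord.
apply: leq_sum => i _.
rewrite -[X in X <= _]card_ord -[X in _ <= X]card_ord.
pose f (x : 'I_(n i)) := c (Tagged (fun i => 'I_(n i)) x).
apply: (@leq_card _ _ f) => x y fxy; apply/eqP/negPn/negP => nxy.
suff /cP : G (Tagged (fun i => 'I_(n i)) x) (Tagged (fun i => 'I_(n i)) y).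
  by rewrite -/(f x) -/(f y) fxy eqxx.
by rewrite /= /blowup_adj /= eqxx andbT eq_Tagged.
Qed.

Lemma card_blowup_vertex : #|blowup_vertex n| = l1norm n.
Proof.
rewrite card_tagged sumnE big_map big_enum /=.
by apply: eq_bigr => i _; rewrite card_ord.
Qed.

(* The colours of an optimal colouring of G are sorted by the set J of parts
   that they meet.  On the vertices whose colour has type J, the parts are
   pairwise non-adjacent cliques, so they can share the colours of G_p. *)
Lemma chi_keep_blowup_le F s D : 0 < s ->
  (forall U, is_clique G U -> colorable_on (keep G F) U (#|U| %/ s + D)) ->
  chi (keep G F) <= chi G %/ s + 2 ^ k * D.
Proof.
move=> s0 cliq; have [c cP] := chiP G.
pose type a : {set 'I_k} := [set i | [exists v, (tag v == i) && (c v == a)]].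
pose m J := #|[set a | type a == J]|.
have sum_m : \sum_J m J = chi G.
  rewrite -[RHS]card_ord -sum1_card (partition_big type predT) //=.
  by apply: eq_bigr => J _; rewrite /m -sum1_card; apply: eq_bigl => a; rewrite !inE.
apply: (@leq_trans (\sum_J (m J %/ s + D))); last first.
  rewrite big_split /= sum_nat_const -cardsT -powersetT card_powerset cardsT card_ord.
  rewrite leq_add2r leq_divRL // -sum_m big_distrl /=.
  by apply: leq_sum => J _; apply: leq_trunc_div.
apply: chi_leP.
apply: (@colorable_onS _ _ _ (\bigcup_J [set x | type (c x) == J])) (leqnn _) _.
  by apply/subsetP => x _; apply/bigcupP; exists (type (c x)); rewrite ?inE.
apply: colorable_on_bigcup => J.
apply: (@colorable_on_components _ _ _ _ (fun x => tag x)) => [i|x y].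
  set U := [set x in _ | _].
  have adjU x y : x \in U -> y \in U -> x != y -> G x y.
    rewrite !inE => /andP[_ /eqP xi] /andP[_ /eqP yi] nxy.
    by rewrite /= /blowup_adj nxy xi yi eqxx.
  apply: colorable_onS (subxx _) _ (cliq U _); last by apply/is_cliqueP.
  rewrite leq_add2r leq_div2r // -(@card_in_imset _ _ c U).
    apply/subset_leq_card/subsetP => a /imsetP[x]; rewrite !inE.
    by move=> /andP[? _] ->.
  move=> x y xU yU cxy; apply/eqP/negPn/negP => /(adjU x y xU yU) /cP.
  by rewrite cxy eqxx.
rewrite !inE => /eqP xJ /eqP yJ /andP[Gxy _].
apply/eqP/negPn/negP => nt; move: (Gxy); rewrite /= /blowup_adj (negPf nt) /=.
case/andP=> _ Hxy.
(* The type of the colour of [y] contains the part of [x], so some [v] in that part shares the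
   colour of [y]; adjacency of the two parts in [H] would make [v] and [y] adjacent. *)
have : tag x \in type (c y) by rewrite yJ -xJ inE; apply/existsP; exists x; rewrite !eqxx.
rewrite inE => /existsP[v /andP[/eqP tv /eqP cv]].
suff /cP : G v y by rewrite cv eqxx.
rewrite /= /blowup_adj tv Hxy orbT andbT.
by apply: contraNneq nt => <-; rewrite tv.
Qed.

End BlowupColoring.

Local Open Scope ring_scope.

(** * Random subsets and Janson's inequality *)

Section RandomSubset.
Variables (R : realType) (T : finType) (p : R).
Hypothesis p01 : 0 < p < 1.
Let q := 1 - p.
Implicit Types (D E F : {set T}) (f g : {set T} -> R).

Definition subset_weight E F : R := p ^+ #|F| * (1 - p) ^+ #|E :\: F|.

Definition expect E f : R := \sum_(F in powerset E) subset_weight E F * f F.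

Let q_gt0 : 0 < q. Proof. by rewrite subr_gt0; case/andP: p01. Qed.

Lemma subset_weight_ge0 E F : 0 <= subset_weight E F.
Proof.
have p0 : 0 < p by case/andP: p01.
by rewrite mulr_ge0 // exprn_ge0 // ltW.
Qed.

Lemma expect_le E f g :
  (forall F, F \subset E -> f F <= g F) -> expect E f <= expect E g.
Proof.
move=> fg; apply: ler_sum => F; rewrite powersetE => sFE.
by rewrite ler_wpM2l ?subset_weight_ge0 ?fg.
Qed.

Lemma expect_ext E f g :
  (forall F, F \subset E -> f F = g F) -> expect E f = expect E g.
Proof.
by move=> fg; apply: eq_bigr => F; rewrite powersetE => sFE; rewrite fg.
Qed.

Lemma expectD E f g : expect E (fun F => f F + g F) = expect E f + expect E g.
Proof. by rewrite -big_split; apply: eq_bigr => F _; rewrite mulrDr. Qed.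

Lemma expectZ E (c : R) f : expect E (fun F => c * f F) = c * expect E f.
Proof. by rewrite mulr_sumr; apply: eq_bigr => F _; rewrite mulrCA. Qed.

Lemma expect_sum E (I : Type) (r : seq I) (P : pred I) (f : I -> {set T} -> R) :
  expect E (fun F => \sum_(i <- r | P i) f i F) =
  \sum_(i <- r | P i) expect E (f i).
Proof. by rewrite exchange_big; apply: eq_bigr => F _; rewrite mulr_sumr. Qed.

Lemma expect_ge0 E f : (forall F, 0 <= f F) -> 0 <= expect E f.
Proof. by move=> f0; apply: sumr_ge0 => F _; rewrite mulr_ge0 ?subset_weight_ge0. Qed.

(** Independence of the traces of the random set on [D] and on its complement, in the form of
    Fubini's theorem. *)
Lemma expect_split D E f : D \subset E ->
  expect E f = expect D (fun A => expect (E :\: D) (fun B => f (A :|: B))).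
Proof.
move=> sDE; rewrite /expect.
under [RHS]eq_bigr do rewrite mulr_sumr.
rewrite pair_big.
rewrite (reindex_onto (fun AB : {set T} * {set T} => AB.1 :|: AB.2)
  (fun F => (F :&: D, F :\: D))) /=; last first.
  by move=> F _; rewrite setID.
apply: eq_big => [[A B]|[A B] /andP[_ /eqP[eA eB]]] /=.
  rewrite !powersetE; apply/idP/idP.
    move=> /andP[sAB /eqP[eA eB]]; apply/andP; split.
      by rewrite -eA subsetIr.
    by rewrite -eB setSD.
  move=> /andP[sAD]; rewrite subsetD => /andP[sBE dBD].
  rewrite subUset (subset_trans sAD) //= sBE /=; apply/eqP; congr pair.
    by rewrite setIUl (setIidPl sAD) (disjoint_setI0 dBD) setU0.
  rewrite setDUl; move: sAD; rewrite -setD_eq0 => /eqP->.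
  by rewrite set0U; apply/setDidPl.
have sAD : A \subset D by rewrite -eA subsetIr.
have dBD : [disjoint B & D].
  rewrite -setI_eq0 -eB; apply/eqP/setP => z; rewrite !inE.
  by case: (z \in D); rewrite ?andbF.
rewrite mulrA; congr (_ * _); rewrite /subset_weight.
have -> : #|A :|: B| = (#|A| + #|B|)%N.
  apply/eqP; rewrite (leq_card_setU A B).2.
  by rewrite disjoint_sym; apply: disjointWr dBD.
have -> : #|E :\: (A :|: B)| = (#|D :\: A| + #|(E :\: D) :\: B|)%N.
  have -> : E :\: (A :|: B) = (D :\: A) :|: (E :\: D :\: B).
    apply/setP => z; rewrite !inE.
    have := subsetP sAD z; have := subsetP sDE z.
    have := disjointFl dBD (x := z).
    case: (z \in D); case: (z \in A); case: (z \in B); case: (z \in E) => //=;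
    by move=> // H1 H2 H3; first [by have := H1 isT | by have := H2 isT | by have := H3 isT].
  apply/eqP; rewrite (leq_card_setU _ _).2 -setI_eq0.
  by apply/eqP/setP => z; rewrite !inE; case: (z \in D); rewrite ?andbF.
by rewrite !exprD; rewrite mulrACA.
Qed.

Lemma expect0 f : expect set0 f = f set0.
Proof.
rewrite /expect powerset0 big_set1 /subset_weight setD0 cards0 !expr0.
by rewrite !mul1r.
Qed.

Lemma expect_set1 e f : expect [set e] f = q * f set0 + p * f [set e].
Proof.
rewrite /expect (bigD1 set0) ?powersetE ?sub0set //=; congr (_ + _).
  by rewrite /subset_weight setD0 cards0 cards1 expr0 mul1r expr1.
rewrite (big_pred1 [set e]) => [|F].
  by rewrite /subset_weight setDv cards0 cards1 expr0 mulr1 expr1.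
rewrite powersetE subset1 /=; case: (eqVneq F [set e]) => [->|_] /=.
  by apply/set0Pn; exists e; rewrite inE.
by rewrite andbN.
Qed.

Lemma expect1 E : expect E (fun=> 1) = 1.
Proof.
have [n] := ubnP #|E|; elim: n E => // n IHn E.
have [->|[e eE]] := set_0Vmem E; first by rewrite expect0.
rewrite ltnS => leEn.
rewrite (@expect_split [set e]) ?sub1set // expect_set1 !IHn ?mulr1 ?subrK //.
by rewrite (cardsD1 e E) eE in leEn.
Qed.

(** Conditioned on missing [D], the random set is distributed as its own part outside [D]. *)
Lemma expect_avoid D E f : D \subset E ->
  expect E (fun F => (F :&: D == set0)%:R * f F) =
  q ^+ #|D| * expect E (fun F => f (F :\: D)).
Proof.
move=> sDE; rewrite (expect_split _ sDE) (expect_split (fun F => f _) sDE).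
have key (A B : {set T}) : A \subset D -> B \subset E :\: D ->
    (A :|: B) :&: D = A /\ (A :|: B) :\: D = B.
  move=> sAD; rewrite subsetD => /andP[sBE dBD]; split.
    by rewrite setIUl (setIidPl sAD) (disjoint_setI0 dBD) setU0.
  rewrite setDUl; move: (sAD); rewrite -setD_eq0 => /eqP->.
  by rewrite set0U; apply/setDidPl.
rewrite [X in _ * X](@expect_ext D _ (fun=> expect (E :\: D) f * 1)); last first.
  move=> A sAD; rewrite mulr1; apply: expect_ext => B sB.
  by rewrite (key A B sAD sB).2.
rewrite expectZ expect1 mulr1 {1}/expect (bigD1 set0) ?powersetE ?sub0set //=.
rewrite [X in _ + X]big1 ?addr0 => [|A].
  rewrite /subset_weight setD0 cards0 expr0 mul1r; congr (_ * _).
  apply: expect_ext => B sB; have [-> _] := key set0 B (sub0set _) sB.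
  by rewrite set0U eqxx mul1r.
rewrite powersetE => /andP[sAD /negPf nA].
rewrite [X in _ * X](_ : _ = 0) ?mulr0 //.
rewrite -[RHS](mul0r (expect (E :\: D) (fun=> 1))) -expectZ.
apply: expect_ext => B sB; rewrite (key A B sAD sB).1 nA.
by rewrite !mul0r.
Qed.

Lemma expect_super D E : D \subset E ->
  expect E (fun F => (D \subset F)%:R) = p ^+ #|D|.
Proof.
move=> sDE; rewrite (expect_split _ sDE) {1}/expect.
rewrite (bigD1 D) ?powersetE //= big1 ?addr0 => [|A].
  rewrite /subset_weight setDv cards0 expr0 mulr1.
  rewrite (@expect_ext _ _ (fun=> 1)) ?expect1 ?mulr1 // => B _.
  by rewrite subsetUl.
rewrite powersetE => /andP[sAD neAD]; rewrite /expect big1 ?mulr0 // => B.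
rewrite powersetE subsetD => /andP[_ dBD].
rewrite (_ : (D \subset A :|: B) = false) ?mulr0 //.
apply: contraNF neAD => sD; rewrite eqEsubset sAD /=.
apply/subsetP => z zD; have := subsetP sD z zD; rewrite inE.
by rewrite (disjointFl dBD zD) orbF.
Qed.

(** The union bound. *)
Lemma expect_le_exists E (I : finType) (P : pred I) (b : I -> {set T} -> bool) :
  expect E (fun F => [exists i in P, b i F]%:R) <=
  \sum_(i in P) expect E (fun F => (b i F)%:R).
Proof.
rewrite -expect_sum; apply: expect_le => F _.
case: existsP => [[i /andP[Pi bi]]|_]; last by apply: sumr_ge0.
by rewrite (bigD1 i) //= bi lerDl; apply: sumr_ge0.
Qed.

(** The lower bound is the Weierstrass product inequality. *)
Lemma prod_subr_ge (I : Type) (r : seq I) (P : pred I) (a : I -> R) :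
  (forall i, 0 <= a i <= 1) ->
  1 - \sum_(i <- r | P i) a i <= \prod_(i <- r | P i) (1 - a i) <= 1.
Proof.
move=> a01; elim: r => [|i r /andP[IH1 IH2]]; first by rewrite !big_nil subr0 !lexx.
rewrite !big_cons; case: ifP => _; last by rewrite IH1.
have /andP[a0 a1] := a01 i.
have P0 : 0 <= \prod_(j <- r | P j) (1 - a j).
  by apply: prodr_ge0 => j _; rewrite subr_ge0; case/andP: (a01 j).
apply/andP; split.
  have : a i * \prod_(j <- r | P j) (1 - a j) <= a i by rewrite ler_piMr.
  lra.
by rewrite mulr_ile1 ?subr_ge0 // gerBl.
Qed.

(* Janson's inequality as a bound on an exponential moment; the parameter x plays
   the role of the retention probability in the usual subsampling argument.
   Since every event is of the form F :&: D = set0, Harris' inequality reduces to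
   the fact that deleting edges from F can only decrease the product. *)
Section Janson.
Variables (E : {set T}) (x : R).
Hypothesis x01 : 0 <= x <= 1.

Let avoid D F : R := (F :&: D == set0)%:R.

Lemma janson_moment (ds : seq {set T}) : all (fun D => D \subset E) ds ->
  expect E (fun F => \prod_(D <- ds) (1 - x * (F :&: D == set0)%:R)) <=
  expR (- x * (\sum_(D <- ds) q ^+ #|D|) + x ^+ 2 *
    (\sum_(D <- ds) \sum_(D' <- ds | D :&: D' != set0) q ^+ #|D :|: D'|)).
Proof.
have [x0 x1] := andP x01.
have xa01 D F : 0 <= x * avoid D F <= 1.
  by rewrite /avoid; case: eqP => _; rewrite ?mulr1 ?mulr0 ?x0 ?x1 ?lexx ?ler01.
elim: ds => [|D ds IH /= /andP[sDE sds]].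
  rewrite !big_nil !mulr0 addr0 expR0 (@expect_ext _ _ (fun=> 1)) ?expect1 //.
  by move=> F _; rewrite big_nil.
pose mom (P : pred {set T}) F := \prod_(D' <- ds | P D') (1 - x * avoid D' F).
have mom_ge0 P F : 0 <= mom P F.
  by apply: prodr_ge0 => D' _; rewrite subr_ge0; case/andP: (xa01 D' F).
have mom_le1 P F : mom P F <= 1.
  by have /andP[] := prod_subr_ge ds P (fun D' => xa01 D' F).
pose M := expect E (mom predT).
pose nu := \sum_(D' <- ds | D :&: D' != set0) q ^+ #|D :|: D'|.
have nu0 : 0 <= nu by apply: sumr_ge0 => D' _; rewrite exprn_ge0 // ltW.
have M0 : 0 <= M by apply: expect_ge0 => F; apply: mom_ge0.
(* The inductive step rests on this: the event that [F] misses [D] keeps at least the share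
   [q ^+ #|D| - x * nu] of the moment [M], where [nu] collects the sets that meet [D] and spoil
   independence. *)
have key : M * (q ^+ #|D| - x * nu) <= expect E (fun F => avoid D F * mom predT F).
  have [neg|pos] := ltP (q ^+ #|D| - x * nu) 0.
    apply: le_trans (expect_ge0 _ _) => [|F].
      by rewrite nmulr_lle0.
    by rewrite mulr_ge0 ?mom_ge0 // /avoid; case: eqP.
  (* The product over the sets disjoint from [D] does not depend on the trace of [F] on [D], so it
     factors out exactly. *)
  pose ind D' := D :&: D' == set0.
  pose I := expect E (mom ind).
  have splitP F : mom predT F = mom ind F * mom (predC ind) F.
    by rewrite /mom (bigID ind) /=.
  apply: (@le_trans _ _ (I * (q ^+ #|D| - x * nu))).
    rewrite ler_wpM2r //; apply: expect_le => F _.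
    by rewrite splitP ler_piMr.
  have eI : expect E (fun F => avoid D F * mom ind F) = q ^+ #|D| * I.
    rewrite expect_avoid //; congr (_ * _); apply: expect_ext => F _.
    apply: eq_bigr => D' /eqP dis; rewrite /avoid.
    have -> // : (F :\: D) :&: D' = F :&: D'.
    apply/setP => z; move/setP/(_ z): dis; rewrite !inE.
    by case: (z \in D); case: (z \in D'); rewrite ?andbF.
  have leI D' : D' \subset E ->
      expect E (fun F => avoid D F * (avoid D' F * mom ind F)) <=
      q ^+ #|D :|: D'| * I.
    move=> sD'.
    rewrite (@expect_ext _ _ (fun F => (F :&: (D :|: D') == set0)%:R * mom ind F)).
      rewrite expect_avoid ?subUset ?sDE // ler_wpM2l ?exprn_ge0 ?(ltW q_gt0) //.
      apply: expect_le => F _; apply: ler_prod => D'' _.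
      rewrite subr_ge0; case/andP: (xa01 D'' (F :\: (D :|: D'))) => _ -> /=.
      rewrite lerD2l lerN2 ler_wpM2l // /avoid; case: eqP => //= e0.
      rewrite (_ : _ :&: _ == set0) //; apply/eqP/setP => z; move/setP/(_ z): e0.
      by rewrite !inE; case: (z \in F) => //=; case: (z \in D''); rewrite ?andbF.
    move=> F _; rewrite mulrA; congr (_ * _).
    by rewrite /avoid -natrM mulnb setIUr setU_eq0.
  (* The product over the sets meeting [D] is replaced by its Weierstrass lower bound. *)
  apply: (@le_trans _ _ (expect E (fun F => avoid D F * mom ind F +
     \sum_(D' <- ds | ~~ ind D') - x * (avoid D F * (avoid D' F * mom ind F))))).
    rewrite expectD expect_sum eI mulrBr [I * _]mulrC lerD2l.
    rewrite mulrC /nu -mulrA -mulNr mulr_suml mulr_sumr.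
    rewrite big_seq_cond [leRHS]big_seq_cond.
    apply: ler_sum => D' /andP[D'ds _]; rewrite expectZ.
    rewrite !mulNr lerN2 ler_wpM2l //.
    by apply: leI; move/allP: sds => /(_ _ D'ds).
  apply: expect_le => F _; rewrite splitP.
  have -> : \sum_(D' <- ds | ~~ ind D') - x * (avoid D F * (avoid D' F * mom ind F))
     = - (avoid D F * mom ind F * \sum_(D' <- ds | ~~ ind D') x * avoid D' F).
    rewrite mulr_sumr -sumrN; apply: eq_bigr => D' _.
    by ring.
  rewrite mulrA -[X in X - _]mulr1 -mulrBr ler_wpM2l //.
    by rewrite mulr_ge0 ?mom_ge0 // /avoid; case: eqP.
  by have /andP[] := prod_subr_ge ds (predC ind) (fun D' => xa01 D' F).
rewrite (@expect_ext _ _ (fun F => mom predT F + - x * (avoid D F * mom predT F)));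
  last by move=> F _; rewrite big_cons -/(mom predT F) -/(avoid D F); ring.
rewrite expectD expectZ -/M.
set S2 := \sum_(D0 <- ds) \sum_(D' <- ds | _) _ in IH *.
set S1 := \sum_(D0 <- ds) _ in IH *.
(* In the double sum over [D :: ds], the row of [D] alone supplies [nu]; its column is dropped. *)
have le2 : S2 + nu <= \sum_(D0 <- D :: ds) \sum_(D' <- D :: ds | D0 :&: D' != set0)
     q ^+ #|D0 :|: D'|.
  rewrite big_cons addrC lerD //.
    by rewrite big_cons; case: ifP => _ //; rewrite lerDr exprn_ge0 // ltW.
  apply: ler_sum => D0 _; rewrite big_cons; case: ifP => _ //.
  by rewrite lerDr exprn_ge0 // ltW.
apply: (@le_trans _ _ (M * (1 - x * (q ^+ #|D| - x * nu)))).
  have := ler_wpM2l x0 key; rewrite /M; lra.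
apply: (@le_trans _ _ (M * expR (- x * (q ^+ #|D| - x * nu)))).
  by rewrite ler_wpM2l // -mulNr expR_ge1Dx.
apply: le_trans (ler_wpM2r (expR_ge0 _) (IH sds)) _.
rewrite -expRD ler_expR big_cons -/S1.
have := ler_wpM2l (sqr_ge0 x) le2.
rewrite !mulrDr; lra.
Qed.
End Janson.
End RandomSubset.

(** * First moment estimates *)

Section Counting.
Variable R : realType.

(** For n > 0 and k <= n, the left side is one term of the binomial expansion of (1 + k/n)^n, which
    is at most e^k. *)
Lemma bin_mul_exp_le (n k : nat) :
  'C(n, k)%:R * (k%:R / n%:R) ^+ k <= expR k%:R :> R.
Proof.
have [->|n0] := posnP n.
  case: k => [|k]; first by rewrite bin0 mul1r expr0 expR0.
  by rewrite bin0n mul0r expR_ge0.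
have [kn|nk] := leqP k n; last by rewrite bin_small // mul0r expR_ge0.
set x : R := k%:R / n%:R.
have x0 : 0 <= x by rewrite divr_ge0.
have -> : k%:R = n%:R * x by rewrite mulrCA mulfV ?mulr1 // pnatr_eq0 -lt0n.
rewrite expRM_natl; apply: (@le_trans _ _ ((1 + x) ^+ n)); last first.
  by rewrite lerXn2r ?nnegrE ?expR_ge0 ?addr_ge0 // expR_ge1Dx.
have kn' : (k < n.+1)%N by rewrite ltnS.
rewrite exprDn (bigD1 (Ordinal kn')) //= expr1n mul1r mulr_natl lerDl.
by apply: sumr_ge0 => i _; rewrite mulrn_wge0 // expr1n mul1r exprn_ge0.
Qed.

Lemma sum_powerset_card (T : finType) (A : {set T}) (g : nat -> R) :
  \sum_(W in powerset A) g #|W| = \sum_(t < #|A|.+1) 'C(#|A|, t)%:R * g t.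
Proof.
rewrite (partition_big (fun W : {set T} => inord #|W| : 'I_#|A|.+1) predT) //=.
apply: eq_bigr => t _; rewrite -cards_draws mulr_natl -sumr_const.
apply: eq_big => [W|W /andP[]]; rewrite !inE.
  case sWA: (W \subset A) => //=; rewrite -val_eqE /= inordK // ltnS.
  exact: subset_leq_card.
by move=> sWA /eqP<-; rewrite inordK // ltnS subset_leq_card.
Qed.

Lemma geometric_sum_le (n : nat) (r : R) : 0 <= r <= 2^-1 ->
  \sum_(t < n | (0 < t)%N) r ^+ t <= 2 * r.
Proof.
move=> /andP[r0 r2]; case: n => [|n]; first by rewrite big_ord0 mulr_ge0.
(* The subtracted term strengthens the bound so that the induction closes. *)
suff : \sum_(t < n.+1 | (0 < t)%N) r ^+ t <= 2 * r - 2 * r ^+ n.+1.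
  by move/le_trans; apply; rewrite gerBl mulr_ge0 ?exprn_ge0.
elim: n => [|n IH]; first by rewrite big_mkcond big_ord1 /= expr1; lra.
rewrite big_mkcond big_ord_recr -big_mkcond /=.
have : r ^+ n.+2 <= 2^-1 * r ^+ n.+1 by rewrite exprS ler_wpM2r ?exprn_ge0.
lra.
Qed.

(** Among n = [#|T|] points there are at most (e n / t)^t sets of size t, and t >= d allows t to be
    replaced by [d] in the denominator; a geometric series remains. *)
Lemma sum_large_sets_le (T : finType) (d : nat) (y : R) :
  (0 < d)%N -> 0 <= y -> expR 1 * (#|T|%:R / d%:R) * y <= 2^-1 ->
  \sum_(A : {set T} | (d <= #|A|)%N) y ^+ #|A| <=
  2 * (expR 1 * (#|T|%:R / d%:R) * y).
Proof.
move=> d0 y0 r2; set r := _ * y.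
have r0 : 0 <= r by rewrite !mulr_ge0 ?expR_ge0 ?invr_ge0.
have -> : \sum_(A : {set T} | (d <= #|A|)%N) y ^+ #|A| =
    \sum_(A in powerset [set: T]) (if (d <= #|A|)%N then y ^+ #|A| else 0).
  by rewrite big_mkcond; apply: eq_bigl => A; rewrite inE subsetT.
rewrite (sum_powerset_card _ (fun t => if (d <= t)%N then y ^+ t else 0)) cardsT.
apply: le_trans (geometric_sum_le #|T|.+1 _); last by rewrite r0.
rewrite [leRHS]big_mkcond; apply: ler_sum => t _.
case: ifP => [dt|_]; last by rewrite mulr0; case: ifP => // _; rewrite exprn_ge0.
have t0 : (0 < t)%N := leq_trans d0 dt.
rewrite t0.
have [T0|T0] := posnP #|T|.
  by have := ltn_ord t; lia.
have := bin_mul_exp_le #|T| t; set C := ('C(_, _)%:R : R) => Cle.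
have tR : 0 < (t : nat)%:R :> R by rewrite ltr0n.
have TR : 0 < #|T|%:R :> R by rewrite ltr0n.
have dR : 0 < d%:R :> R by rewrite ltr0n.
apply: (@le_trans _ _ ((expR 1 * (#|T|%:R / t%:R) * y) ^+ t)).
  rewrite exprMn ler_wpM2r ?exprn_ge0 // exprMn -expRM_natl mulr1.
  rewrite -[#|T|%:R / _]invrK invf_div exprVn.
  by rewrite ler_pdivlMr // exprn_gt0 // divr_gt0.
rewrite lerXn2r ?nnegrE ?mulr_ge0 ?expR_ge0 ?invr_ge0 ?ler0n //.
rewrite /r ler_wpM2r // ler_wpM2l ?expR_ge0 // ler_wpM2l //.
by rewrite lef_pV2 ?posrE // ler_nat.
Qed.

(** Division-free form of the fact that C(m-l, s-l) / C(m, s), a product of ratios (s-i)/(m-i), is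
    at most (s/m)^l. *)
Lemma bin_sub_mulX_le (m s l : nat) : (l <= s)%N -> (s <= m)%N ->
  ('C(m - l, s - l) * m ^ l <= 'C(m, s) * s ^ l)%N.
Proof.
move=> ls sm; elim: l ls => [|l IH] ls; first by rewrite !subn0 !expn0.
have {}IH := IH (ltnW ls).
have [m' Em] : exists m', (m - l = m'.+1)%N by exists (m - l).-1; lia.
have [s' Es] : exists s', (s - l = s'.+1)%N by exists (s - l).-1; lia.
have -> : (m - l.+1 = m')%N by lia.
have -> : (s - l.+1 = s')%N by lia.
rewrite Em Es in IH.
have E := mul_bin_diag m'.+1 s'; rewrite /= in E.
have h : ('C(m', s') * m <= s * 'C(m'.+1, s'.+1))%N.
  rewrite -(leq_pmul2l (ltn0Sn m')) mulnA E.
  rewrite -!mulnA [X in (_ <= X)%N]mulnA.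
  have : (s'.+1 * m <= m'.+1 * s)%N by nia.
  by move=> hh; nia.
rewrite !expnS mulnA; apply: leq_trans (leq_mul h (leqnn _)) _.
by rewrite -mulnA [X in (_ <= X)%N]mulnCA leq_mul2l IH orbT.
Qed.

Lemma card_draws_super_le (T : finType) (U W : {set T}) (s : nat) :
  W \subset U -> (#|[set B : {set T} | [&& B \subset U, #|B| == s & W \subset B]]|
    <= 'C(#|U| - #|W|, s - #|W|))%N.
Proof.
move=> sWU; rewrite -(cardsDS sWU) -cards_draws.
rewrite -(@card_in_imset _ _ (fun B : {set T} => B :\: W)); last first.
  move=> B C; rewrite !inE => /and3P[_ _ sB] /and3P[_ _ sC] E.
  by rewrite -(setID B W) -(setID C W) E (setIidPr sB) (setIidPr sC).
apply/subset_leq_card/subsetP => X /imsetP[B]; rewrite !inE => /and3P[sB /eqP cB sWB] ->.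
by rewrite setSD //= cardsDS // cB.
Qed.

Lemma exists_subset_card (T : finType) (A : {set T}) (j : nat) :
  (j <= #|A|)%N -> exists2 K : {set T}, K \subset A & #|K| = j.
Proof.
move=> jA; have : (0 < #|[set K : {set T} | K \subset A & #|K| == j]|)%N.
  by rewrite cards_draws bin_gt0.
by case/card_gt0P => K; rewrite inE => /andP[sK /eqP cK]; exists K.
Qed.

End Counting.

(** * The three bad events and their probabilities *)

Section Percolation.
Variables (R : realType) (V : finType) (G : sgraph V) (p : R).
Hypothesis p01 : 0 < p < 1.
Let q := 1 - p.
Let E := edges G.
Implicit Types (F : {set {set V}}) (T U A B : {set V}).

Let p_gt0 : 0 < p. Proof. by case/andP: p01. Qed.
Let q_gt0 : 0 < q. Proof. by rewrite subr_gt0; case/andP: p01. Qed.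
Let q_le1 : q <= 1. Proof. by rewrite gerBl ltW. Qed.

Lemma percolation_probE (a : sgraph V -> bool) :
  percolation_prob G p a = expect p E (fun F => (a (keep G F))%:R).
Proof.
rewrite /percolation_prob big_mkcondr; apply: eq_bigr => F _.
by rewrite /subset_weight; case: (a _); rewrite ?mulr1 ?mulr0.
Qed.

Lemma inner_edges_sub T : inner_edges G T \subset E.
Proof. by apply/subsetP => e; rewrite mem_inner_edges => /andP[]. Qed.

Lemma expect_independent T :
  expect p E (fun F => (independent (keep G F) T)%:R) = q ^+ #|inner_edges G T|.
Proof.
have := expect_avoid p (fun=> 1) (inner_edges_sub T).
rewrite expect1 // mulr1 => <-; apply: expect_ext => F sF.
by rewrite independent_keep // mulr1.
Qed.

Definition dense_independent d F : bool :=
  [exists T in [pred T : {set V} | (T != set0) && [forall x in T, (d <= deg_in G T x)%N]],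
    independent (keep G F) T].

(** A set T of minimum degree [d] spans at least d|T|/2 edges of [G], so it is independent with
    probability at most (sqrt q)^(d|T|); these bounds are summed over T. *)
Lemma dense_independent_prob d : (0 < d)%N ->
  expR 1 * (#|V|%:R / d%:R) * Num.sqrt q ^+ d <= 2^-1 ->
  expect p E (fun F => (dense_independent d F)%:R) <=
  2 * (expR 1 * (#|V|%:R / d%:R) * Num.sqrt q ^+ d).
Proof.
move=> d0 r2; apply: le_trans (expect_le_exists p01 _ _ _) _.
have y0 : 0 <= Num.sqrt q ^+ d by rewrite exprn_ge0 ?sqrtr_ge0.
apply: le_trans (sum_large_sets_le d0 y0 r2).
rewrite big_mkcond [leRHS]big_mkcond; apply: ler_sum => T _ /=.
case: ifP => [/andP[nT /forall_inP dT]|_]; last first.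
  by case: ifP => // _; rewrite exprn_ge0.
(* A vertex of [T] has [d] neighbours in [T], so [T] has at least [d] elements; this gains the
   factor 1/d in the union bound. *)
have [x xT] := set0Pn _ nT.
have -> : (d <= #|T|)%N.
  apply: leq_trans (dT x xT) _; apply/subset_leq_card/subsetP => z.
  by rewrite inE => /andP[].
rewrite expect_independent -exprM.
have -> : q ^+ #|inner_edges G T| = Num.sqrt q ^+ (2 * #|inner_edges G T|).
  by rewrite exprM sqr_sqrtr // ltW.
have s1 : Num.sqrt q <= 1 by rewrite -sqrtr1 ler_wsqrtr.
rewrite ler_wiXn2l ?sqrtr_ge0 //.
apply: leq_trans (sum_deg_in_le G T).
by rewrite mulnC -sum_nat_const; apply: leq_sum => z zT; apply: dT.
Qed.

(** Off this event, every set of at most [m] vertices spans a [2 * D]-colourable subgraph of the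
    percolated graph, by degeneracy. *)
Definition dense_small m D F : bool :=
  [exists T in [pred T : {set V} | (0 < #|T| <= m)%N],
    [forall x in T, (2 * D <= deg_in (keep G F) T x)%N]].

(** Minimum degree 2D on t vertices forces Dt kept edges. A union bound over their choice among at
    most t^2/2 edges gives (e t p / 2D)^(Dt), which is at most 2^(-Dt) by the hypothesis on [D]. *)
Lemma dense_small_prob m D : (0 < D)%N -> expR 1 * p * m%:R <= D%:R ->
  (expR 1 : R) * #|V|%:R * 2^-1 ^+ D <= 2^-1 ->
  expect p E (fun F => (dense_small m D F)%:R) <=
  2 * ((expR 1 : R) * #|V|%:R * 2^-1 ^+ D).
Proof.
move=> D0 hD r2; apply: le_trans (expect_le_exists p01 _ _ _) _.
have y0 : 0 <= 2^-1 ^+ D :> R by rewrite exprn_ge0 // invr_ge0.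
have := @sum_large_sets_le R V 1 _ isT y0; rewrite divr1 => /(_ r2).
apply: le_trans.
rewrite big_mkcond [leRHS]big_mkcond; apply: ler_sum => T _ /=.
rewrite inE; case: ifP => [/andP[T0 Tm]|_]; last by case: ifP => // _; rewrite exprn_ge0.
rewrite T0 -exprM.
set t := #|T| in T0 Tm *.
pose draws := [set K : {set {set V}} | K \subset inner_edges G T & #|K| == (D * t)%N].
apply: (@le_trans _ _ (expect p E (fun F => [exists K in draws, K \subset F]%:R))).
  apply: (expect_le p01) => F sF.
  case: (boolP [forall x in T, _]) => [/forall_inP dT|//].
  have : (D * t <= #|F :&: inner_edges G T|)%N.
    rewrite -(leq_pmul2l (isT : (0 < 2)%N)) -inner_edges_keep //.
    apply: leq_trans (sum_deg_in_le _ _).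
    by rewrite mulnA mulnC -sum_nat_const; apply: leq_sum => z zT; apply: dT.
  case/exists_subset_card => K sK cK; rewrite (_ : [exists _ in _, _]) //.
  apply/existsP; exists K; rewrite inE cK eqxx andbT.
  by rewrite (subset_trans sK (subsetIl _ _)) (subset_trans sK (subsetIr _ _)).
apply: le_trans (expect_le_exists p01 _ _ _) _.
rewrite (eq_bigr (fun=> p ^+ (D * t))); last first.
  move=> K; rewrite inE => /andP[sK /eqP cK].
  by rewrite expect_super // ?cK // (subset_trans sK (inner_edges_sub T)).
rewrite sumr_const cards_draws -[leLHS]mulr_natl.
set M := #|inner_edges G T|.
have Mle : (2 * M <= t * t)%N.
  have := card_inner_edges_le G T; rewrite -/M -/t bin2.
  by move=> h; apply: (@leq_trans (2 * (t * t.-1)./2)); nia.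
have [->|M0] := posnP M.
  by rewrite bin0n (gtn_eqF (_ : (0 < D * t)%N)) ?muln_gt0 ?D0 // mul0r exprn_ge0 // invr_ge0.
have Dt0 : 0 < (D * t)%:R :> R by rewrite ltr0n muln_gt0 D0.
have MR : 0 < M%:R :> R by rewrite ltr0n.
have := bin_mul_exp_le R M (D * t); set C := ('C(_, _)%:R : R) => Cle.
apply: (@le_trans _ _ ((expR 1 * (M%:R / (D * t)%:R) * p) ^+ (D * t))).
  rewrite exprMn ler_wpM2r ?exprn_ge0 ?(ltW p_gt0) // exprMn -expRM_natl mulr1.
  rewrite -[M%:R / _]invrK invf_div exprVn.
  by rewrite ler_pdivlMr // exprn_gt0 // divr_gt0.
rewrite lerXn2r ?nnegrE ?mulr_ge0 ?expR_ge0 ?invr_ge0 ?ler0n ?(ltW p_gt0) //.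
rewrite mulrAC mulrA ler_pdivrMr //.
have Mle' : 2 * M%:R <= t%:R * t%:R :> R by rewrite -!natrM ler_nat.
have tm : t%:R <= m%:R :> R by rewrite ler_nat.
have e0 : 0 <= expR 1 * p by rewrite mulr_ge0 ?expR_ge0 ?ltW.
have t0 : 0 <= t%:R :> R by [].
rewrite natrM.
have h1 : expR 1 * p * (2 * M%:R) <= expR 1 * p * (t%:R * t%:R) by rewrite ler_wpM2l.
have h2 : expR 1 * p * t%:R <= D%:R by apply: le_trans hD; rewrite ler_wpM2l.
have h3 : expR 1 * p * t%:R * t%:R <= D%:R * t%:R by rewrite ler_wpM2r.
lra.
Qed.

(** * Janson's inequality for the independent sets of a clique *)

Section Clique.
Variables (U : {set V}) (s : nat).
Hypotheses (cU : is_clique G U) (s2 : (2 <= s)%N) (sm : (s <= #|U|)%N).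
Let m := #|U|.

(* A bound for Delta / mu^2 in Janson's inequality for the s-subsets of a clique of
   size m, where l is the size of the intersection of two of them. *)
Definition overlap (m s : nat) : R :=
  \sum_(l < s.+1 | (2 <= l)%N)
    'C(s, l)%:R * (s%:R / m%:R) ^+ l * q^-1 ^+ 'C(l, 2).

Let draws := [set A : {set V} | A \subset U & #|A| == s].
Let mu : R := 'C(m, s)%:R * q ^+ 'C(s, 2).

Let m_gt0 : 0 < m%:R :> R. Proof. by rewrite ltr0n; lia. Qed.

Lemma bin_sub_le (l : nat) : (l <= s)%N ->
  'C(m - l, s - l)%:R <= 'C(m, s)%:R * (s%:R / m%:R) ^+ l :> R.
Proof.
move=> ls; have := bin_sub_mulX_le ls sm.
rewrite -(ler_nat R) !natrM !natrX expr_div_n mulrA ler_pdivlMr ?exprn_gt0 //.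
Qed.

(** The term l = [s], which stands for pairs of equal sets, is already large enough. This keeps the
    parameter of the moment bound below 1. *)
Lemma overlap_mu_ge1 : 1 <= overlap m s * mu.
Proof.
have ss : (s < s.+1)%N by [].
apply: (@le_trans _ _ ('C(s, s)%:R * (s%:R / m%:R) ^+ s * q^-1 ^+ 'C(s, 2) * mu)).
  rewrite binn mul1r exprVn /mu.
  rewrite [X in _ <= _ * X]mulrC mulrA mulfVK ?expf_neq0 ?gt_eqF //.
  by have := bin_sub_le (leqnn s); rewrite subnn bin0 mulrC.
have mu0 : 0 <= mu by rewrite mulr_ge0 // exprn_ge0 // ltW.
rewrite ler_wpM2r // /overlap (bigD1 (Ordinal ss)) //= lerDl.
by apply: sumr_ge0 => l _; rewrite !mulr_ge0 ?exprn_ge0 ?invr_ge0 ?mulr_ge0 ?invr_ge0 ?ler0n ?ltW.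
Qed.

(** The sets B are grouped by W, their intersection with [A]. The union of the two edge sets has 2
    C(s,2) - C(|W|,2) elements, and a common edge forces |W| >= 2. *)
Lemma sum_overlapping_le A : A \in draws ->
  \sum_(B in draws | inner_edges G A :&: inner_edges G B != set0)
    q ^+ #|inner_edges G A :|: inner_edges G B| <=
  q ^+ 'C(s, 2) * mu * overlap m s.
Proof.
rewrite inE => /andP[sAU /eqP cA].
have cl (X : {set V}) : X \subset U -> #|inner_edges G X| = 'C(#|X|, 2).
  by move=> sX; apply: card_inner_edges_clique; apply: is_cliqueS sX cU.
pose h (W : {set V}) : R := (2 <= #|W|)%N%:R * q^-1 ^+ 'C(#|W|, 2).
have h0 W : 0 <= h W by rewrite mulr_ge0 // exprn_ge0 // invr_ge0 ltW.
have qc0 : 0 <= q ^+ 'C(s, 2) * q ^+ 'C(s, 2).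
  by rewrite mulr_ge0 // exprn_ge0 // ltW.
have c0 W : 0 <= q ^+ 'C(s, 2) * q ^+ 'C(s, 2) * h W := mulr_ge0 qc0 (h0 W).
apply: (@le_trans _ _ (\sum_(B in draws) q ^+ 'C(s, 2) * q ^+ 'C(s, 2) * h (A :&: B))).
  rewrite big_mkcondr; apply: ler_sum => B; rewrite inE => /andP[sBU /eqP cB].
  case: ifP => [nz|_]; last exact: c0.
  have sIU : A :&: B \subset U by apply: subset_trans sAU; apply: subsetIl.
  have cI : #|inner_edges G A :&: inner_edges G B| = 'C(#|A :&: B|, 2).
    by rewrite inner_edgesI cl.
  have h2 : (2 <= #|A :&: B|)%N.
    rewrite leqNgt; apply: contraNN nz => lt2.
    by rewrite -cards_eq0 cI bin_small.
  rewrite /h h2 mul1r exprVn ler_pdivlMr ?exprn_gt0 // -!exprD.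
  by rewrite -cI cardsUI !cl // cA cB.
apply: (@le_trans _ _ (\sum_(W in powerset A) \sum_(B in draws | W \subset B)
    q ^+ 'C(s, 2) * q ^+ 'C(s, 2) * h W)).
  rewrite (partition_big (fun B => A :&: B) (mem (powerset A))) /=; last first.
    by move=> B _; rewrite powersetE subsetIl.
  apply: ler_sum => W _; rewrite big_mkcondr [leRHS]big_mkcondr; apply: ler_sum => B _.
  case: eqP => [<-|_]; first by rewrite subsetIr.
  by case: ifP => // _; apply: c0.
have le1 W : W \in powerset A ->
   \sum_(B in draws | W \subset B) q ^+ 'C(s, 2) * q ^+ 'C(s, 2) * h W <=
   q ^+ 'C(s, 2) * mu * ((s%:R / m%:R) ^+ #|W| * ((2 <= #|W|)%N%:R * q^-1 ^+ 'C(#|W|, 2))).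
  rewrite powersetE => sWA.
  have ls : (#|W| <= s)%N by rewrite -cA subset_leq_card.
  rewrite sumr_const -[leLHS]mulr_natl -/(h W).
  have := card_draws_super_le s (subset_trans sWA sAU).
  have -> : #|[set B : {set V} | [&& B \subset U, #|B| == s & W \subset B]]| =
     #|(fun i : {set V} => (i \in draws) && (W \subset i))|.
    by apply: eq_card => B; rewrite [RHS]unfold_in !inE -andbA.
  rewrite -(ler_nat R) => /le_trans/(_ (bin_sub_le ls)) hle.
  apply: le_trans (ler_wpM2r (c0 W) hle) _; rewrite /mu.
  by rewrite le_eqVlt; apply/orP; left; apply/eqP; rewrite /h; ring.
apply: le_trans (ler_sum _ le1) _; rewrite -mulr_sumr.
rewrite (sum_powerset_card A (fun t =>
  ((s%:R / m%:R) ^+ t * ((2 <= t)%N%:R * q^-1 ^+ 'C(t, 2))))) cA /overlap.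
rewrite [X in _ <= _ * X]big_mkcond /=.
rewrite le_eqVlt; apply/orP; left; apply/eqP; congr (_ * _).
apply: eq_bigr => l _; case: ifP => _; rewrite ?mul1r ?mul0r ?mulr0 //.
by rewrite mulrA.
Qed.

Lemma no_independent_prob :
  expect p E (fun F =>
    (~~ [exists A in draws, independent (keep G F) A])%:R) <=
  expR (- (4 * overlap m s)^-1).
Proof.
have mu_ge0 : 0 <= mu by rewrite mulr_ge0 // exprn_ge0 // ltW.
have k1 := overlap_mu_ge1.
have mu0 : 0 < mu.
  by rewrite lt_neqAle mu_ge0 andbT; apply: contraTneq k1 => <-; rewrite mulr0 ler10.
have k0 : 0 < overlap m s.
  by rewrite -(pmulr_lgt0 _ mu0); apply: lt_le_trans k1.
(* This value minimises the exponent - x mu + x^2 mu^2 overlap of the moment bound; the minimum is -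
   1 / (4 overlap). *)
pose x := (2 * (overlap m s * mu))^-1.
have x0 : 0 <= x by rewrite invr_ge0 ltW // mulr_gt0 // mulr_gt0.
have x1 : x <= 1 by rewrite invf_le1; lra.
have x01 : 0 <= x <= 1 by rewrite x0.
pose ds := [seq inner_edges G A | A <- enum draws].
have sds : all (fun D : {set {set V}} => D \subset E) ds.
  by apply/allP => D /mapP[A _ ->]; apply: inner_edges_sub.
apply: le_trans (le_trans (janson_moment p01 x01 sds) _).
  apply: (expect_le p01) => F sF.
  have xa (A : {set {set V}}) : 0 <= 1 - x * (F :&: A == set0)%:R.
    by case: eqP => _; rewrite ?mulr1 ?mulr0 ?subr0 ?subr_ge0.
  (* The product dominates the indicator: when no [s]-subset is independent, every factor equals
     1. *)
  case: existsP => [_|no]; first by apply: prodr_ge0 => A _.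
  rewrite big_map big_enum big1 // => A Adr.
  rewrite -independent_keep // (_ : independent _ _ = false) ?mulr0 ?subr0 //.
  by apply/negP => ind; apply: no; exists A; rewrite Adr.
rewrite ler_expR !big_map.
have clA A : A \in draws -> #|inner_edges G A| = 'C(s, 2).
  rewrite inE => /andP[sAU /eqP <-].
  by apply: card_inner_edges_clique; apply: is_cliqueS sAU cU.
have -> : \sum_(A <- enum draws) q ^+ #|inner_edges G A| = mu.
  rewrite big_enum (eq_bigr (fun=> q ^+ 'C(s, 2))) => [|A /clA->//].
  by rewrite sumr_const cards_draws -[LHS]mulr_natl.
have D2 : \sum_(A <- enum draws) \sum_(D' <- ds | inner_edges G A :&: D' != set0)
     q ^+ #|inner_edges G A :|: D'| <= mu ^+ 2 * overlap m s.
  rewrite big_enum.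
  apply: (@le_trans _ _ (\sum_(A in draws) q ^+ 'C(s, 2) * mu * overlap m s)).
    apply: ler_sum => A Adr; rewrite big_map big_enum_cond.
    exact: sum_overlapping_le.
  rewrite sumr_const cards_draws -/m -[leLHS]mulr_natl le_eqVlt.
  by apply/orP; left; apply/eqP; rewrite /mu; ring.
apply: le_trans (lerD (lexx _) (ler_wpM2l (sqr_ge0 x) D2)) _.
rewrite le_eqVlt; apply/orP; left; apply/eqP; rewrite /x; field.
by rewrite !gt_eqF.
Qed.

End Clique.

(** Testing cliques with exactly [m] vertices is enough, as larger ones contain such a clique. *)
Definition poor_clique m s F : bool :=
  [exists U in [pred U : {set V} | is_clique G U && (#|U| == m)],
    ~~ [exists A in [set A : {set V} | A \subset U & #|A| == s],
         independent (keep G F) A]].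

(** A union bound over at most 2^N vertex sets, which the exponent of Janson's inequality has to
    beat. *)
Lemma poor_clique_prob m s : (2 <= s)%N -> (s <= m)%N ->
  expect p E (fun F => (poor_clique m s F)%:R) <=
  2 ^+ #|V| * expR (- (4 * overlap m s)^-1).
Proof.
move=> s2 sm; apply: le_trans (expect_le_exists p01 _ _ _) _.
apply: (@le_trans _ _ (\sum_(U in powerset [set: V]) expR (- (4 * overlap m s)^-1))).
  rewrite big_mkcond [leRHS]big_mkcond; apply: ler_sum => U _.
  rewrite powersetE subsetT inE; case: ifP => [/andP[cU /eqP mU]|_]; last exact: expR_ge0.
  by rewrite -mU in sm *; apply: no_independent_prob.
by rewrite sumr_const card_powerset cardsT -[leLHS]mulr_natl natrX.
Qed.

End Percolation.

(** * From the bad events to bounds on the chromatic number *)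

Section BlowupPercolation.
Variables (R : realType) (k : nat) (H : sgraph 'I_k) (n : 'I_k -> nat) (p : R).
Hypothesis p01 : 0 < p < 1.
Let G := blowup H n.

Lemma chi_keep_bounds (d s m D : nat) (F : {set {set blowup_vertex n}}) :
  (0 < s)%N -> ~~ dense_independent G d F -> ~~ dense_small G m D F ->
  ~~ poor_clique G m s F ->
  (chi G <= chi (keep G F) * d)%N /\
  (chi (keep G F) <= chi G %/ s + 2 ^ k * (2 * D))%N.
Proof.
move=> s0 nA nB nC; split.
  apply: chi_le_keepM => T nT dT; apply: contraNN nA => ind.
  apply/existsP; exists T; rewrite ind andbT inE nT /=.
  exact/forall_inP.
apply: chi_keep_blowup_le => // U cU; apply: (@greedy_colorable _ _ _ _ m) => // W sWU.
  case/exists_subset_card => W' sW' cW'.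
  have cl' : is_clique G W' by apply: is_cliqueS cU; apply: subset_trans sWU.
  have : [exists A in [set A : {set blowup_vertex n} | A \subset W' & #|A| == s],
      independent (keep G F) A].
    apply: contraNT nC => no; apply/existsP; exists W'.
    by rewrite no andbT inE cl' cW' /=.
  case/existsP => A /andP[]; rewrite inE => /andP[sAW /eqP cA] ind.
  by exists A; split=> //; apply: subset_trans sW'.
move=> cW; apply: degenerate_colorable => T sTW nT.
have : ~~ [forall x in T, (2 * D <= deg_in (keep G F) T x)%N].
  apply: contraNN nB => dT; apply/existsP; exists T.
  rewrite dT andbT inE card_gt0 nT /=.
  exact: leq_trans (subset_leq_card sTW) cW.
by rewrite negb_forall_in => /exists_inP[x xT]; rewrite -ltnNge; exists x.
Qed.

Lemma percolation_chi_prob_ge (d s m D : nat) (a : sgraph (blowup_vertex n) -> bool) :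
  (0 < s)%N ->
  (forall F, (chi G <= chi (keep G F) * d)%N ->
    (chi (keep G F) <= chi G %/ s + 2 ^ k * (2 * D))%N -> a (keep G F)) ->
  1 - (expect p (edges G) (fun F => (dense_independent G d F)%:R) +
       expect p (edges G) (fun F => (dense_small G m D F)%:R) +
       expect p (edges G) (fun F => (poor_clique G m s F)%:R))
  <= percolation_prob G p a <= 1.
Proof.
move=> s0 aP; rewrite percolation_probE; apply/andP; split; last first.
  rewrite -[leRHS](expect1 p (edges G)); apply: (expect_le p01) => F _.
  by case: (a _).
rewrite lerBlDr -[leLHS](expect1 p (edges G)) -!expectD.
apply: (expect_le p01) => F _.
case: (boolP (dense_independent _ _ _)) => nA; first by rewrite -!natrD ler1n; lia.
case: (boolP (dense_small _ _ _ _)) => nB; first by rewrite -!natrD ler1n; lia.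
case: (boolP (poor_clique _ _ _ _)) => nC; first by rewrite -!natrD ler1n; lia.
by have [h1 h2] := chi_keep_bounds s0 nA nB nC; rewrite (aP F) ?addr0.
Qed.

End BlowupPercolation.

(** * Choice of the parameters *)

Lemma bin_le_expn (n l : nat) : ('C(n, l) <= n ^ l)%N.
Proof.
elim: l n => [|l IH] n; first by rewrite bin0 expn0.
apply: (@leq_trans (n * 'C(n.-1, l))); first by rewrite mul_bin_diag leq_pmull.
rewrite expnS leq_mul2l; apply/orP; right; apply: leq_trans (IH _) _.
by case: l {IH} => // l; rewrite leq_exp2r // leq_pred.
Qed.

Lemma bin_le_2expn (n l : nat) : ('C(n, l) <= 2 ^ n)%N.
Proof.
elim: n l => [|n IH] [|l]; rewrite ?bin0 ?expn_gt0 //.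
by rewrite binS expnS mul2n -addnn leq_add.
Qed.

Lemma bin2_double_le (n : nat) : (2 * 'C(n, 2) <= n * n)%N.
Proof.
rewrite bin2 mul2n; apply: (@leq_trans (n * n.-1)).
  by rewrite -[leqRHS]odd_double_half leq_addl.
by rewrite leq_mul2l leq_pred orbT.
Qed.

Lemma sum_ltn_le (n K : nat) : (\sum_(l < n) (l < K) <= K)%N.
Proof.
suff : (\sum_(l < n) (l < K) <= minn n K)%N by move/leq_trans; apply; apply: geq_minr.
elim: n => [|n IH]; first by rewrite big_ord0.
by rewrite big_ord_recr /=; move: IH; case: (ltnP n K) => /= h1 h2; lia.
Qed.

(* The exponentials are generalized because comparing them as atoms, up to
   conversion, would unfold their definition. *)
Ltac elra :=
  repeat match goal with |- context [expR ?t] => generalize (expR t) end;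
  intros; lra.

Section Estimates.
Variable R : realType.

(** The overlap size l falls in three ranges. Below [K], the factor b^2 with b = s^2/m dominates and
    q^(-C(l,2)) is at most exp(eps x / 2). From [K] to s/4, q^(-C(l,2)) is at most exp(l x / 4),
    which b^l absorbs. Above s/4, C(s,l) is at most 16^l and q^(-C(l,2)) at most exp(l L s / 2),
    which the last hypothesis controls. *)
Lemma overlap_le (eps a x L P p : R) (K s m : nat) :
  0 < eps -> 0 < a <= 1 -> 0 <= x -> 1 - p = expR (- L) -> 0 <= L -> P <= x ->
  8 <= a * K%:R -> L * (K ^ 2)%:R <= eps / 2 * x ->
  L * s%:R <= 2 * P -> (0 < m)%N ->
  s%:R ^+ 2 / m%:R <= expR (- (2^-1 + eps / 2) * x) :> R ->
  16 * (s%:R / m%:R) * expR (L * s%:R / 2) <= expR (- (a / 4) * x) :> R ->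
  overlap p m s <= K%:R * expR (- (1 + eps / 2) * x) + s.+1%:R * expR (- 2 * x).
Proof.
move=> eps0 /andP[a0 a1] x0 qE L0 Px aK LK Ls m0 h1 h2.
set A := expR (- (1 + eps / 2) * x); set B := expR (- 2 * x).
have A0 : 0 <= A := expR_ge0 _.
have B0 : 0 <= B := expR_ge0 _.
apply: (@le_trans _ _ (\sum_(l < s.+1) ((l < K)%N%:R * A + B))); last first.
  rewrite big_split /= sumr_const card_ord -[B *+ _]mulr_natl lerD2r.
  by rewrite -mulr_suml ler_wpM2r // -natr_sum ler_nat sum_ltn_le.
rewrite /overlap big_mkcond; apply: ler_sum => l _.
case: ifP => [l2|_]; last by rewrite addr_ge0 // mulr_ge0.
have ls : (l <= s)%N by rewrite -ltnS.
rewrite qE -expRN opprK -expRM_natr.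
have mR : 0 < m%:R :> R by rewrite ltr0n.
set b := s%:R ^+ 2 / m%:R in h1.
have b0 : 0 <= b by rewrite divr_ge0 // exprn_ge0.
have sm0 : 0 <= s%:R / m%:R :> R by rewrite divr_ge0.
have Cb : 'C(s, l)%:R * (s%:R / m%:R) ^+ l <= b ^+ l :> R.
  have -> : b = s%:R * (s%:R / m%:R) by rewrite /b expr2 mulrA.
  rewrite [leRHS]exprMn; apply: ler_wpM2r; first by rewrite exprn_ge0.
  by rewrite -natrX ler_nat bin_le_expn.
have ll : (2 * 'C(l, 2) <= l * l)%N by apply: bin2_double_le.
have llR : 2 * 'C(l, 2)%:R <= l%:R * l%:R :> R by rewrite -!natrM ler_nat.
have CbE : 0 <= 'C(s, l)%:R * (s%:R / m%:R) ^+ l :> R.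
  by rewrite mulr_ge0 // exprn_ge0.
have [lK|Kl] := ltnP l K.
  rewrite mul1r; apply: (@le_trans _ _ A); last by rewrite lerDl.
  apply: (@le_trans _ _ (expR (- (2^-1 + eps / 2) * x) ^+ 2 * expR (eps / 2 * x))).
    apply: ler_pM => //; first exact: expR_ge0.
      apply: le_trans Cb _; apply: le_trans (_ : b ^+ 2 <= _).
        apply: ler_wiXn2l => //; apply: le_trans h1 _.
        by rewrite -[leRHS]expR0 ler_expR mulNr oppr_le0 mulr_ge0 //; lra.
      by rewrite lerXn2r ?nnegrE ?expR_ge0.
    rewrite ler_expR; apply: le_trans LK; rewrite ler_wpM2l // ler_nat.
    apply: leq_trans (_ : l * l <= _)%N; first by rewrite (leq_trans _ ll) // leq_pmull.
    by rewrite expnS expn1 leq_mul // ltnW.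
  rewrite -expRM_natl -expRD ler_expR.
  by have : 0 <= eps * x := mulr_ge0 (ltW eps0) x0; lra.
rewrite mul0r add0r.
have KR : K%:R <= l%:R :> R by rewrite ler_nat.
(* The size of [K] enters here: a l >= 8 turns a saving of exp(- a x / 4) per element into exp(- 2
   x). *)
have al : 8 <= a * l%:R by apply: le_trans aK _; rewrite ler_wpM2l // ltW.
have l8 : 8 <= l%:R :> R.
  by apply: le_trans al _; rewrite ger_pMl // ltr0n (ltn_trans _ l2).
have lR : 0 <= l%:R :> R by [].
have [l4|l4] := leqP (4 * l) s.
  have l4R : 4 * l%:R <= s%:R :> R by rewrite -natrM ler_nat.
  have e1 : L * 'C(l, 2)%:R <= l%:R * (x / 4).
    have t1 : L * (2 * 'C(l, 2)%:R) <= L * (l%:R * l%:R) by rewrite ler_wpM2l.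
    have t2 : L * (4 * l%:R) <= 2 * x.
      by apply: le_trans (le_trans (ler_wpM2l L0 l4R) Ls) _; rewrite ler_pM2l.
    have t3 := ler_wpM2l lR t2.
    lra.
  apply: (@le_trans _ _ (expR (- (2^-1 + eps / 2) * x) ^+ l * expR (l%:R * (x / 4)))).
    apply: ler_pM => //; first exact: expR_ge0.
      by apply: le_trans Cb _; rewrite lerXn2r ?nnegrE ?expR_ge0.
    by rewrite ler_expR.
  rewrite -expRM_natl -expRD ler_expR.
  have t4 : 0 <= l%:R * (eps * x) by rewrite !mulr_ge0 // ltW.
  have t5 : 8 * x <= l%:R * x by rewrite ler_wpM2r.
  lra.
apply: (@le_trans _ _ ((16 * (s%:R / m%:R)) ^+ l * expR (L * s%:R / 2) ^+ l)).
  apply: ler_pM => //; first exact: expR_ge0.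
    rewrite [leRHS]exprMn; apply: ler_wpM2r; first by rewrite exprn_ge0.
    rewrite -natrX ler_nat; apply: leq_trans (bin_le_2expn _ _) _.
    by rewrite -[16%N]/(2 ^ 4)%N -expnM leq_exp2l // ltnW.
  rewrite -expRM_natl ler_expR.
  have lsR : l%:R <= s%:R :> R by rewrite ler_nat.
  have t1 : L * (2 * 'C(l, 2)%:R) <= L * (l%:R * l%:R) by rewrite ler_wpM2l.
  have t2 := ler_wpM2l lR (ler_wpM2l L0 lsR).
  lra.
rewrite -exprMn; apply: le_trans (_ : expR (- (a / 4) * x) ^+ l <= _).
  by rewrite lerXn2r ?nnegrE ?expR_ge0 // mulr_ge0 ?expR_ge0 // mulr_ge0.
rewrite -expRM_natl ler_expR.
have := ler_wpM2r x0 al; lra.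
Qed.

(* Here x = ln N, L = - ln (1 - p) and P = ln (p N). *)
Section Choices.
Variables (eps a x p e0 L P alpha gamma : R) (N K k : nat).
Hypotheses (eps0 : 0 < eps) (eps4 : eps < 4^-1) (a0 : 0 < a) (a10 : a <= 10^-1).
Hypotheses (NE : N%:R = expR x) (x0 : 1 <= x) (p01 : 0 < p < 1).
Hypotheses (qE : 1 - p = expR (- L)) (pNE : p * N%:R = expR P).
Hypothesis alphaE : alpha = 2 * P / L.
Hypothesis plow : expR ((- 4^-1 + eps) * x) <= p.
Hypotheses (aK : 8 <= a * K%:R) (LK : L * (K ^ 2)%:R <= eps / 2 * x) (La : L <= a * x).
Hypotheses (g0 : 0 < gamma) (geps : gamma <= eps) (ga : gamma <= a / 4).
Hypothesis e00 : 0 < e0.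

Let p_gt0 : 0 < p.
Proof. by case/andP: p01. Qed.
Let p_lt1 : p < 1.
Proof. by case/andP: p01. Qed.
Let x_gt0 : 0 < x.
Proof. by apply: lt_le_trans x0. Qed.

Let pL : p <= L.
Proof. by have := expR_ge1Dx (- L); rewrite -qE; lra. Qed.

Let L_gt0 : 0 < L.
Proof. exact: lt_le_trans pL. Qed.

Let P_le : P <= x.
Proof. by rewrite -ler_expR -pNE -NE ler_piMl // ltW. Qed.

Let ex0 : 0 < eps * x.
Proof. by rewrite mulr_gt0. Qed.

Let P_ge : 3 / 4 * x <= P.
Proof.
rewrite -ler_expR -pNE NE.
apply: (@le_trans _ _ (expR ((- 4^-1 + eps) * x) * expR x)).
  by rewrite -expRD ler_expR; have := ex0; lra.
by rewrite ler_wpM2r ?expR_ge0.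
Qed.

Let P_gt0 : 0 < P.
Proof. by apply: lt_le_trans P_ge; rewrite mulr_gt0 // divr_gt0. Qed.

Let alpha_gt0 : 0 < alpha.
Proof. by rewrite alphaE divr_gt0 // mulr_gt0. Qed.

Let Lalpha : L * alpha = 2 * P.
Proof. by rewrite alphaE mulrC mulfVK // gt_eqF. Qed.

Let alpha_le : alpha <= 2 * x / p.
Proof.
have P2 : 0 <= 2 * P by rewrite mulr_ge0 // ltW.
rewrite alphaE ler_pM ?invr_ge0 ?(ltW L_gt0) //.
- by rewrite ler_pM2l.
- by rewrite lef_pV2 ?posrE.
Qed.

Let ax0 : 0 < a * x.
Proof. by rewrite mulr_gt0. Qed.
Let ax1 : a * x <= 10^-1 * x.
Proof. by rewrite ler_wpM2r // ltW. Qed.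

Let aP_ge : 3 / 4 * (a * x) <= a * P.
Proof.
have -> : 3 / 4 * (a * x) = a * (3 / 4 * x) by ring.
by rewrite ler_pM2l.
Qed.

(** Since L <= a x while P >= 3x/4. Rounding [d] and [s] to integers then costs at most a further
    [a * alpha]. *)
Let alpha_ge : 1 <= a * alpha.
Proof.
rewrite -(ler_pM2r L_gt0) mul1r -mulrA [alpha * L]mulrC Lalpha.
have := aP_ge; have := ax0; have := La; lra.
Qed.

Let aal : a * alpha <= 10^-1 * alpha.
Proof. by rewrite ler_wpM2r // ltW. Qed.

(** For p <= 1/2 one has L <= 2p, hence 2 p alpha >= 2P >= 1; for larger p it is enough that alpha
    >= 10. *)
Let N_alpha : N%:R / alpha <= 2 * (p * N%:R).
Proof.
rewrite ler_pdivrMr // (_ : _ * alpha = 2 * p * alpha * N%:R); last by ring.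
rewrite ler_peMl ?ler0n //.
have [p2|p2] := leP p 2^-1.
  have q0 : 0 < 1 - p by rewrite subr_gt0.
  have Lp : L <= 2 * p.
    have h : 1 + L <= (1 - p)^-1 by rewrite qE -expRN opprK expR_ge1Dx.
    have h' : (1 - p)^-1 <= 1 + 2 * p.
      rewrite -[leLHS]mul1r ler_pdivrMr //.
      have : 0 <= p * (1 - 2 * p) by rewrite mulr_ge0 ?(ltW p_gt0) //; lra.
      lra.
    lra.
  have : L * alpha <= 2 * p * alpha by rewrite ler_pM2r.
  by rewrite Lalpha; have := P_ge; have := x0; lra.
have : alpha * 2^-1 <= alpha * p by rewrite ler_pM2l // ltW.
have := alpha_ge; have := aal; lra.
Qed.

(** With d just above (1 + a) alpha, (1 - p)^(d/2) is at most (pN)^(-(1+a)) while N/d is at most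
    2pN, so the quantity is at most 2e (pN)^(-a). *)
Lemma dense_independent_params :
  4 * expR 1 <= e0 * expR (a / 2 * x) ->
  exists d : nat, [/\ (0 < d)%N,
  expR 1 * (N%:R / d%:R) * Num.sqrt (1 - p) ^+ d <= e0 / 2 &
  d%:R <= (1 + 2 * a) * alpha].
Proof.
move=> big1.
pose d := (Num.truncn ((1 + a) * alpha)).+1.
have da : (1 + a) * alpha < d%:R by apply: truncnS_gt.
have aa0 : 0 <= (1 + a) * alpha by rewrite mulr_ge0 ?(ltW alpha_gt0) //; have := a0; lra.
have aal0 : 0 < a * alpha by rewrite mulr_gt0.
exists d; split=> //; last first.
  rewrite /d -natr1; have : (Num.truncn ((1 + a) * alpha))%:R <= (1 + a) * alpha.
    by rewrite truncn_le.
  by have := alpha_ge; lra.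
have d_gt0 : 0 < d%:R :> R by rewrite ltr0n.
have h1 : N%:R / d%:R <= 2 * expR P.
  rewrite -pNE; apply: le_trans N_alpha; rewrite ler_wpM2l // lef_pV2 ?posrE //.
  by apply: le_trans (ltW da); lra.
have h2 : Num.sqrt (1 - p) ^+ d <= expR (- ((1 + a) * P)).
  have -> : Num.sqrt (1 - p) = expR (- L / 2).
    have -> : 1 - p = expR (- L / 2) ^+ 2.
      by rewrite qE -expRM_natl; congr expR; field.
    by rewrite sqrtr_sqr ger0_norm ?expR_ge0.
  rewrite -expRM_natr ler_expR.
  have : L * ((1 + a) * alpha) <= L * d%:R by rewrite ler_pM2l // ltW.
  rewrite mulrCA Lalpha; lra.
apply: (@le_trans _ _ (expR 1 * (2 * expR P) * expR (- ((1 + a) * P)))).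
  rewrite ler_pM ?exprn_ge0 ?sqrtr_ge0 // ?mulr_ge0 ?expR_ge0 ?invr_ge0 //.
  by rewrite ler_wpM2l ?expR_ge0.
rewrite -mulrA -mulrA -expRD.
have -> : P - (1 + a) * P = - (a * P) by ring.
have h3 : expR (a / 2 * x) <= expR (a * P).
  by rewrite ler_expR; have := aP_ge; have := ax0; lra.
rewrite mulrA expRN ler_pdivrMr ?expR_gt0 //.
move: (ler_wpM2l (ltW e00) h3) big1; elra.
Qed.

Let m := (Num.truncn (expR ((1 - gamma) * x))).+1.

Let m_ge : expR ((1 - gamma) * x) <= m%:R.
Proof. exact/ltW/truncnS_gt. Qed.

Let gx : gamma * x <= eps * x.
Proof. by rewrite ler_wpM2r // ltW. Qed.
Let gx' : gamma * x <= a / 4 * x.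
Proof. by rewrite ler_wpM2r // ltW. Qed.

Let m_le : m%:R <= 2 * expR ((1 - gamma) * x).
Proof.
have : (Num.truncn (expR ((1 - gamma) * x)))%:R <= expR ((1 - gamma) * x).
  by rewrite truncn_le expR_ge0.
have : 1 <= expR ((1 - gamma) * x).
  by rewrite -[leLHS]expR0 ler_expR; have := gx'; have := ax1; have := x_gt0; lra.
by rewrite /m -natr1; elra.
Qed.

Let pm_ge : expR (x / 2) <= p * m%:R.
Proof.
apply: (@le_trans _ _ (expR ((- 4^-1 + eps) * x) * expR ((1 - gamma) * x))).
  by rewrite -expRD ler_expR; have := gx; have := x_gt0; lra.
by rewrite ler_pM ?expR_ge0.
Qed.

(** D is about e p m. As p m >= N^(1/2), D is at least 4 ln N and N 2^(-D) is O(1/N); as alpha <= 2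
    ln N / p, the factor p cancels in D alpha, which is O(N^(1-gamma) ln N). *)
Lemma dense_small_params :
  4 * x <= expR (x / 2) -> 2 * expR 1 <= e0 * expR x ->
  16 * expR 1 * (2 ^ k)%:R * k%:R * x <= a * expR (gamma * x) ->
  exists D : nat, [/\ (0 < D)%N,
  expR 1 * p * m%:R <= D%:R,
  expR 1 * N%:R * 2^-1 ^+ D <= e0 / 2 &
  (2 ^ k * (2 * D))%:R * k%:R * alpha <= a * N%:R].
Proof.
move=> big2 big3 big8.
pose D := (Num.truncn (expR 1 * p * m%:R)).+1.
have Dge : expR 1 * p * m%:R < D%:R by apply: truncnS_gt.
have e1 : 1 <= expR 1 :> R by rewrite -[leLHS]expR0 ler_expR.
have pm0 : 0 <= p * m%:R by rewrite mulr_ge0 // ltW.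
have epm : expR (x / 2) <= expR 1 * p * m%:R.
  by apply: le_trans pm_ge _; rewrite -mulrA ler_peMl.
exists D; split=> //; first exact: ltW.
  have D4 : 4 * x <= D%:R.
    by apply: le_trans big2 (le_trans epm (ltW Dge)).
  have h : 2^-1 ^+ D <= expR (- (2 * x)).
    apply: (@le_trans _ _ (expR (- 2^-1) ^+ D)).
      rewrite lerXn2r ?nnegrE ?expR_ge0 ?invr_ge0 //.
      by have := @expR_ge1Dx R (- 2^-1); elra.
    by rewrite -expRM_natl ler_expR; move: D4; elra.
  apply: (@le_trans _ _ (expR 1 * N%:R * expR (- (2 * x)))).
    by rewrite ler_wpM2l // mulr_ge0 ?expR_ge0.
  rewrite NE -mulrA -expRD.
  have -> : x - 2 * x = - x by ring.
  by rewrite expRN ler_pdivrMr ?expR_gt0 //; move: big3; elra.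
have Dle : D%:R <= 4 * expR 1 * p * expR ((1 - gamma) * x).
  have : (Num.truncn (expR 1 * p * m%:R))%:R <= expR 1 * p * m%:R.
    by rewrite truncn_le !mulr_ge0 ?expR_ge0 // ltW.
  have : 1 <= expR (x / 2) by rewrite -[leLHS]expR0 ler_expR divr_ge0 // ltW.
  have : expR 1 * p * m%:R <= expR 1 * p * (2 * expR ((1 - gamma) * x)).
    by rewrite ler_wpM2l // mulr_ge0 ?expR_ge0 // ltW.
  have -> : D%:R = (Num.truncn (expR 1 * p * m%:R))%:R + 1 :> R by rewrite natr1.
  by move: epm; elra.
rewrite !natrM.
have k0 : 0 <= (2 ^ k)%:R * 2 * k%:R :> R by rewrite !mulr_ge0.
apply: (@le_trans _ _ ((2 ^ k)%:R * 2 * k%:R * (2 * x / p) *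
    (4 * expR 1 * p * expR ((1 - gamma) * x)))).
  rewrite (_ : _ * alpha = (2 ^ k)%:R * 2 * k%:R * alpha * D%:R); last by ring.
  rewrite ler_pM //; first by rewrite mulr_ge0 // ltW.
  by rewrite ler_wpM2l.
have -> : (2 ^ k)%:R * 2 * k%:R * (2 * x / p) * (4 * expR 1 * p * expR ((1 - gamma) * x)) =
   (16 * expR 1 * (2 ^ k)%:R * k%:R * x) * expR ((1 - gamma) * x).
  by field; rewrite gt_eqF.
apply: le_trans (ler_wpM2r (expR_ge0 _) big8) _.
by rewrite -mulrA -expRD NE ler_wpM2l ?(ltW a0) // ler_expR; lra.
Qed.

(** With s the integer part of (1 - a) alpha, the overlap sum is at most 1/(8N), so Janson's
    exponent is at least 2N and outweighs the 2^N vertex sets. *)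
Lemma poor_clique_params :
  2 * expR 1 <= e0 * expR x -> 2 * x <= expR (eps / 4 * x) ->
  32 * x <= expR (a / 4 * x) -> 16 * K%:R <= expR (eps / 2 * x) ->
  32 <= expR (x / 2) ->
  exists s : nat, [/\ (2 <= s)%N, (s <= m)%N,
  2 ^+ N * expR (- (4 * overlap p m s)^-1) <= e0 &
  (1 - 2 * a) * alpha <= s%:R].
Proof.
move=> big3 big4 big5 big6 big7.
pose s := Num.truncn ((1 - a) * alpha).
have aa0 : 0 <= (1 - a) * alpha by rewrite mulr_ge0 ?(ltW alpha_gt0) //; have := a10; lra.
have sle : s%:R <= (1 - a) * alpha by rewrite truncn_le.
have sge : (1 - 2 * a) * alpha <= s%:R.
  have := truncnS_gt ((1 - a) * alpha); rewrite -/s -natr1.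
  by have := alpha_ge; lra.
have s2 : (2 <= s)%N.
  by rewrite -(ler_nat R); have := alpha_ge; have := aal; move: sge; elra.
have s0 : 0 <= s%:R :> R by [].
have sa : s%:R <= alpha by apply: le_trans sle _; have := alpha_ge; lra.
(* From alpha <= 2x/p and p >= N^(-1/4+eps) follows s <= N^(1/4 - 3 eps/4), so that s^2/m is at most
   N^(-1/2 - eps/2); this is where the exponent 1/4 is used. *)
have sx : s%:R <= expR ((4^-1 - 3 / 4 * eps) * x).
  apply: le_trans sa (le_trans alpha_le _).
  have -> : (4^-1 - 3 / 4 * eps) * x = eps / 4 * x + - ((- 4^-1 + eps) * x) by field.
  rewrite expRD expRN ler_pM ?invr_ge0 ?(ltW p_gt0) //.
    by rewrite mulr_ge0 // ltW.
  by rewrite lef_pV2 ?posrE ?expR_gt0.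
have sm : (s <= m)%N.
  rewrite -(ler_nat R); apply: le_trans sx (le_trans _ m_ge).
  by rewrite ler_expR; have := gx'; have := ax1; have := ex0; have := x_gt0; elra.
have m0 : 0 < m%:R :> R by rewrite ltr0n.
exists s; split=> //.
have N0 : 0 < N%:R :> R by rewrite NE expR_gt0.
have kap : overlap p m s <= (8 * N%:R)^-1.
  apply: (le_trans (@overlap_le eps a x L P p K s m _ _ _ _ _ _ _ _ _ _ _ _)) => //.
  - by rewrite a0 /=; have := a10; elra.
  - exact: ltW.
  - exact: ltW.
  - by rewrite -Lalpha ler_wpM2l // ltW.
  - rewrite ler_pdivrMr //.
    apply: (@le_trans _ _ (expR ((4^-1 - 3 / 4 * eps) * x) ^+ 2)).
      by rewrite lerXn2r ?nnegrE ?expR_ge0.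
    apply: (@le_trans _ _ (expR (- (2^-1 + eps / 2) * x) * expR ((1 - gamma) * x))).
      by rewrite -expRM_natl -expRD ler_expR; have := gx; have := ex0; elra.
    by rewrite ler_wpM2l ?expR_ge0.
  - have h1 : expR (L * s%:R / 2) <= expR ((1 - a) * P).
      rewrite ler_expR; have : L * s%:R <= L * ((1 - a) * alpha) by rewrite ler_wpM2l // ltW.
      by rewrite mulrCA Lalpha; elra.
    have h2 : s%:R / m%:R <= 2 * x / p / expR ((1 - gamma) * x).
      rewrite ler_pM ?invr_ge0 //; first exact: le_trans sa alpha_le.
      by rewrite lef_pV2 ?posrE ?expR_gt0.
    apply: (@le_trans _ _ (16 * (2 * x / p / expR ((1 - gamma) * x)) * expR ((1 - a) * P))).
      rewrite ler_pM ?expR_ge0 ?mulr_ge0 ?invr_ge0 //.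
      by rewrite ler_wpM2l.
    (* Writing (pN)^(1-a) as pN (pN)^(-a) lets p cancel against the bound on s/m, leaving 32 x
       N^gamma (pN)^(-a). *)
    have -> : expR ((1 - a) * P) = p * expR x / expR (a * P).
      by rewrite -NE pNE -expRN -expRD; congr expR; ring.
    have -> : 16 * (2 * x / p / expR ((1 - gamma) * x)) * (p * expR x / expR (a * P)) =
      (32 * x) * (expR x / expR ((1 - gamma) * x) / expR (a * P)).
      by field; rewrite ?gt_eqF ?expR_gt0.
    apply: (@le_trans _ _ (expR (a / 4 * x) * (expR x / expR ((1 - gamma) * x) / expR (a * P)))).
      by rewrite ler_wpM2r // !mulr_ge0 ?invr_ge0 ?expR_ge0.
    rewrite -!expRN -!expRD ler_expR.
    by have := aP_ge; have := gx'; have := ax0; elra.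
  rewrite NE.
  have t1 : K%:R * expR (- (1 + eps / 2) * x) <= 16^-1 * expR (- x).
    have -> : expR (- x) = expR (eps / 2 * x) * expR (- (1 + eps / 2) * x).
      by rewrite -expRD; congr expR; ring.
    by rewrite mulrA ler_wpM2r ?expR_ge0 //; move: big6; elra.
  have t2 : s.+1%:R * expR (- 2 * x) <= 16^-1 * expR (- x).
    have -> : - 2 * x = - x + - x by ring.
    rewrite expRD mulrA ler_wpM2r ?expR_ge0 //.
    have h3 : s.+1%:R <= 2 * expR (x / 2).
      have : 1 <= expR (x / 2) by rewrite -[leLHS]expR0 ler_expR divr_ge0 // ltW.
      have : s%:R <= expR (x / 2).
        by apply: le_trans sx _; rewrite ler_expR; have := ex0; have := x_gt0; elra.
      by rewrite -natr1; elra.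
    apply: le_trans (ler_wpM2r (expR_ge0 _) h3) _.
    rewrite -mulrA -expRD (_ : x / 2 - x = - (x / 2)); last by field.
    by rewrite expRN ler_pdivrMr ?expR_gt0 //; move: big7; elra.
  by rewrite invfM -expRN; move: t1 t2; elra.
have kap0 : 0 < overlap p m s.
  have ss : (s < s.+1)%N by [].
  rewrite /overlap (bigD1 (Ordinal ss)) //= ltr_pwDl //.
    rewrite binn mul1r mulr_gt0 // exprn_gt0 ?invr_gt0 ?subr_gt0 //.
    by rewrite divr_gt0 // ltr0n (ltn_trans _ s2).
  apply: sumr_ge0 => l _.
  by rewrite !mulr_ge0 ?exprn_ge0 ?invr_ge0 ?subr_ge0 ?(ltW p_lt1) ?divr_ge0.
have inv : 2 * N%:R <= (4 * overlap p m s)^-1.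
  rewrite -[leLHS]invrK lef_pV2 ?posrE ?invr_gt0 ?mulr_gt0 //.
  have -> : (2 * N%:R)^-1 = 4 * (8 * N%:R)^-1 :> R by field; rewrite gt_eqF.
  by rewrite ler_pM2l.
(* 2^N is bounded by e^N, and the resulting e^(-N) is at most e^(-x) because N = e^x >= x. *)
apply: (@le_trans _ _ (expR 1 ^+ N * expR (- (2 * N%:R)))).
  rewrite ler_pM ?exprn_ge0 ?expR_ge0 // ?ler_expR ?lerN2 //.
  by rewrite lerXn2r ?nnegrE ?expR_ge0 //; have := @expR_ge1Dx R 1; elra.
rewrite -expRM_natl -expRD mulr1.
have -> : N%:R - 2 * N%:R = - N%:R :> R by ring.
apply: (@le_trans _ _ (expR (- x))).
  by rewrite ler_expR lerN2 NE; have := expR_ge1Dx x; elra.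
rewrite expRN -[leLHS]mul1r ler_pdivrMr ?expR_gt0 //.
by have := @expR_ge1Dx R 1; move: big3; elra.
Qed.

End Choices.
End Estimates.

(* Passage to the limit *)
From mathcomp Require Import all_classical all_reals all_analysis.
Import numFieldNormedType.Exports.
Local Open Scope classical_set_scope.
Local Open Scope ring_scope.

(** Here [x] stands for the chromatic number of G and [c] for that of the percolated graph; N <= k x
    makes the additive error at most a x / alpha. The factors 1/(1+2a) and 1/(1-2a) are replaced by
    1 - 2a and 1 + 3a, and 10 a <= delta leaves room. *)
Lemma chi_window (R : realType) (a delta alpha : R) (N k x c d s D : nat) :
  0 < a -> a <= 10^-1 -> 10 * a <= delta -> 0 < alpha -> (0 < N)%N ->
  (N <= k * x)%N -> (0 < s)%N ->
  d%:R <= (1 + 2 * a) * alpha -> (1 - 2 * a) * alpha <= s%:R ->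
  (2 ^ k * (2 * D))%:R * k%:R * alpha <= a * N%:R ->
  (x <= c * d)%N -> (c <= x %/ s + 2 ^ k * (2 * D))%N ->
  (1 - delta) * (alpha^-1 * x%:R) <= c%:R <= (1 + delta) * (alpha^-1 * x%:R).
Proof.
move=> a0 a10 ad al0 N0 Nkx s0 hd hs hD h1 h2.
set y := alpha^-1 * x%:R.
have xE : x%:R = alpha * y by rewrite /y mulrA mulfV ?mul1r // gt_eqF.
have y0 : 0 <= y by rewrite mulr_ge0 // invr_ge0 ltW.
have ay0 : 0 <= a * y by rewrite mulr_ge0 // ltW.
have ady : 10 * a * y <= delta * y by rewrite ler_wpM2r.
have aay : a * (a * y) <= 10^-1 * (a * y) by rewrite ler_wpM2r.
have c0 : 0 <= c%:R :> R by [].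
apply/andP; split.
  have : x%:R <= c%:R * ((1 + 2 * a) * alpha).
    by apply: le_trans (_ : (c * d)%:R <= _); rewrite ?ler_nat // natrM ler_wpM2l.
  rewrite xE mulrA [_ * alpha]mulrC ler_pM2l // => yc.
  have a20 : 0 <= 1 - 2 * a by lra.
  have := ler_wpM2l a20 yc.
  have : 0 <= c%:R * (a * a) by rewrite !mulr_ge0 // ltW.
  lra.
have k0 : 0 < k%:R :> R.
  rewrite ltr0n lt0n; apply/eqP => k0; move: Nkx.
  by rewrite k0 mul0n leqNgt N0.
set B := (2 ^ k * (2 * D))%N in hD h2.
have By : B%:R <= a * y.
  have : B%:R * k%:R * alpha <= a * (k%:R * x%:R).
    by apply: le_trans hD _; rewrite ler_pM2l // -natrM ler_nat.
  rewrite xE.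
  have -> : a * (k%:R * (alpha * y)) = (a * y) * (k%:R * alpha) by ring.
  by rewrite -mulrA ler_pM2r // mulr_gt0.
have xs : (x %/ s)%:R <= (1 + 3 * a) * y.
  have sR : 0 < s%:R :> R by rewrite ltr0n.
  apply: (@le_trans _ _ (x%:R / s%:R)).
    by rewrite ler_pdivlMr // -natrM ler_nat leq_divM.
  rewrite ler_pdivrMr // xE.
  have y3 : 0 <= (1 + 3 * a) * y by rewrite mulr_ge0 //; lra.
  apply: le_trans (ler_wpM2l y3 hs).
  have -> : (1 + 3 * a) * y * ((1 - 2 * a) * alpha) =
     alpha * (y + a * y - 6 * (a * (a * y))) by ring.
  by rewrite ler_pM2l //; lra.
have : c%:R <= (x %/ s)%:R + B%:R :> R by rewrite -natrD ler_nat.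
lra.
Qed.

(** For t >= 0, exp(t) >= (t/2)^2, and a quadratic eventually exceeds a linear function. *)
Lemma near_linear_le_expR (R : realType) (C c : R) : 0 < c ->
  \forall x \near +oo, C * x <= expR (c * x).
Proof.
move=> c0; near=> x.
have x0 : 0 <= x by near: x; apply: nbhs_pinfty_ge.
have xC : 4 * C / c ^+ 2 <= x by near: x; apply: nbhs_pinfty_ge; rewrite num_real.
apply: (@le_trans _ _ ((c * x / 2) ^+ 2)).
  rewrite ler_pdivrMr ?exprn_gt0 // in xC.
  have := ler_wpM2r x0 xC.
  have -> : (c * x / 2) ^+ 2 = x * c ^+ 2 * x / 4 by field.
  lra.
have -> : c * x = 2%:R * (c * x / 2) by field.
rewrite expRM_natl.
have -> : 2 * (c * x / 2) / 2 = c * x / 2 by field.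
rewrite lerXn2r ?nnegrE ?expR_ge0 ?divr_ge0 ?mulr_ge0 ?(ltW c0) //.
by have := expR_ge1Dx (c * x / 2); lra.
Unshelve. all: by end_near. Qed.

Lemma near_cst_le_expR (R : realType) (C c : R) : 0 < c ->
  \forall x \near +oo, C <= expR (c * x).
Proof.
move=> c0; near=> x.
apply: le_trans (expR_ge1Dx _).
have : C / c <= x by near: x; apply: nbhs_pinfty_ge; rewrite num_real.
by rewrite ler_pdivrMr //; lra.
Unshelve. all: by end_near. Qed.

Theorem theorem1p3 (R : realType) (eps : R) (heps : 0 < eps < 4^-1)
    (k : nat) (H : sgraph 'I_k) (nn : nat -> 'I_k -> nat) (p : nat -> R)
    (hp : forall n, 0 < p n < 1)
    (hn : l1norm (nn n) @[n --> \oo] --> \oo)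
    (hlow : \forall n \near \oo,
      (l1norm (nn n))%:R `^ (- 4^-1 + eps) <= p n)
    (hup : exists2 eta : nat -> R, eta n @[n --> \oo] --> (0 : R) &
      \forall n \near \oo, 1 - p n = (l1norm (nn n))%:R `^ (- eta n))
    (delta : R) (hdelta : 0 < delta) :
  percolation_prob (blowup H (nn n)) (p n) (fun Gp =>
    let Y := ln (1 / (1 - p n)) / (2 * ln (p n * #|blowup_vertex (nn n)|%:R))
               * (chi (blowup H (nn n)))%:R in
    (1 - delta) * Y <= (chi Gp)%:R <= (1 + delta) * Y)
  @[n --> \oo] --> (1 : R).
Proof.
have [eps0 eps4] := andP heps.
case: hup => eta eta0 hup.
(* [a] is the relative slack in [d] and [s]. *)
pose a := Num.min delta 1 / 10.
have md0 : 0 < Num.min delta 1 by rewrite lt_min hdelta ltr01.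
have a0 : 0 < a by rewrite divr_gt0.
have a10 : a <= 10^-1 by rewrite /a ler_piMl // ?invr_ge0 // ge_min lexx orbT.
have ad : 10 * a <= delta by rewrite /a mulrC divfK // ge_min lexx.
(* The first entry serves the bound on s^2/m, the second the large overlaps. *)
pose gamma := Num.min eps (a / 4).
have g0 : 0 < gamma by rewrite lt_min eps0 divr_gt0.
have geps : gamma <= eps by rewrite ge_min lexx.
have ga : gamma <= a / 4 by rewrite ge_min lexx orbT.
pose K := (Num.truncn (8 / a)).+1.
have aK : 8 <= a * K%:R by rewrite mulrC -ler_pdivrMr // ltW // truncnS_gt.
have K2 : 0 < (K ^ 2)%:R :> R by rewrite ltr0n expn_gt0.
(* Since L = o(x), eventually L <= tau x; the two entries of the minimum give [La] and [LK]. *)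
pose tau := Num.min a (eps / 2 / (K ^ 2)%:R).
have tau0 : 0 < tau by rewrite lt_min a0 !divr_gt0.
apply/cvgrPdist_le => e e_gt0.
(* A third of the error for each bad event; the cap at 1 keeps e0/2 within the 1/2 required by the
   geometric sums. *)
pose e0 := Num.min e 1 / 3.
have me0 : 0 < Num.min e 1 by rewrite lt_min e_gt0 ltr01.
have e00 : 0 < e0 by rewrite divr_gt0.
have e0e : 3 * e0 <= e by rewrite /e0 mulrC divfK // ge_min lexx.
have e01 : e0 <= 1.
  have : Num.min e 1 <= 1 by rewrite ge_min lexx orbT.
  by rewrite /e0; lra.
pose x n : R := ln (l1norm (nn n))%:R.
have hx : x n @[n --> \oo] --> +oo.
  apply/cvgryPge => A.
  have [B hB] : exists B : nat, expR A <= B%:R.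
    by exists (Num.truncn (expR A)).+1; rewrite ltW // truncnS_gt.
  have h : \forall n \near \oo, (B <= l1norm (nn n))%N by move/cvgnyPge: hn; apply.
  apply: filterS h => n BN.
  rewrite -[A]expRK ler_ln ?posrE ?expR_gt0 //; last first.
    by apply: lt_le_trans (expR_gt0 A) (le_trans hB _); rewrite ler_nat.
  by apply: le_trans hB _; rewrite ler_nat.
have big (Q : R -> Prop) : (\forall y \near +oo, Q y) -> \forall n \near \oo, Q (x n).
  exact: hx.
have e00' : e0 != 0 by rewrite gt_eqF.
pose N n := l1norm (nn n).
near=> n.
have N0 : (0 < N n)%N by near: n; move/cvgnyPge: hn; apply.
have NR : 0 < (N n)%:R :> R by rewrite ltr0n.
have x1 : 1 <= x n by near: n; apply: (big (fun y => 1 <= y)); apply: nbhs_pinfty_ge.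
have NE : (N n)%:R = expR (x n) by rewrite lnK.
have p01 := hp n; have [p0 p1] := andP p01.
have q0 : 0 < 1 - p n by rewrite subr_gt0.
pose L := ln (1 / (1 - p n)).
pose P := ln (p n * (N n)%:R).
pose alpha := 2 * P / L.
have qE : 1 - p n = expR (- L).
  by rewrite /L div1r lnV ?posrE // opprK lnK.
have pNE : p n * (N n)%:R = expR P by rewrite lnK // posrE mulr_gt0.
have plow : expR ((- 4^-1 + eps) * x n) <= p n.
  have : (N n)%:R `^ (- 4^-1 + eps) <= p n by near: n.
  by rewrite /powR gt_eqF.
have Ltau : L <= tau * x n.
  (* The hypothesis 1 - p = N^(-eta) reads L = eta x, with eta tending to 0. *)
  have -> : L = eta n * x n.
    rewrite /L div1r lnV ?posrE //.
    have -> : 1 - p n = (N n)%:R `^ (- eta n) by near: n.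
    by rewrite ln_powR mulNr opprK.
  rewrite ler_wpM2r ?(le_trans _ x1) //; apply: le_trans (ler_norm _) _.
  by near: n; move/cvgr0Pnorm_le: eta0; apply.
have x_ge0 : 0 <= x n by apply: le_trans x1.
have La : L <= a * x n.
  by apply: le_trans Ltau _; rewrite ler_wpM2r // ge_min lexx.
have LK : L * (K ^ 2)%:R <= eps / 2 * x n.
  apply: le_trans (ler_wpM2r (ltW K2) Ltau) _.
  rewrite mulrAC ler_wpM2r // -ler_pdivlMr //.
  by rewrite ge_min lexx orbT.
have [d [d0 hdA hd]] : exists d : nat, [/\ (0 < d)%N,
    expR 1 * ((N n)%:R / d%:R) * Num.sqrt (1 - p n) ^+ d <= e0 / 2 &
    d%:R <= (1 + 2 * a) * alpha].
  apply: (@dense_independent_params R eps a (x n) (p n) e0 L P alpha (N n)) => //.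
  rewrite -ler_pdivrMl //; near: n.
  by apply: (big (fun y => _ <= expR (a / 2 * y))); apply: near_cst_le_expR; rewrite divr_gt0.
set m := (Num.truncn (expR ((1 - gamma) * x n))).+1.
have big3 : 2 * expR 1 <= e0 * expR (x n).
  rewrite -ler_pdivrMl // -[x n]mul1r; near: n.
  by apply: (big (fun y => _ <= expR (1 * y))); apply: near_cst_le_expR.
have [D [D0 hDm hDA hD]] : exists D : nat, [/\ (0 < D)%N,
    expR 1 * p n * m%:R <= D%:R, expR 1 * (N n)%:R * 2^-1 ^+ D <= e0 / 2 &
    (2 ^ k * (2 * D))%:R * k%:R * alpha <= a * (N n)%:R].
  apply: (@dense_small_params R eps a (x n) (p n) e0 L P alpha gamma (N n) k) => //.
    rewrite [x n / 2]mulrC; near: n.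
    by apply: (big (fun y => 4 * y <= expR (2^-1 * y))); apply: near_linear_le_expR.
  rewrite -ler_pdivrMl // mulrA; near: n.
  by apply: (big (fun y => _ * y <= expR (gamma * y))); apply: near_linear_le_expR.
have [s [s2 sm hsA hs]] : exists s : nat, [/\ (2 <= s)%N, (s <= m)%N,
    2 ^+ N n * expR (- (4 * overlap (p n) m s)^-1) <= e0 &
    (1 - 2 * a) * alpha <= s%:R].
  apply: (@poor_clique_params R eps a (x n) (p n) e0 L P alpha gamma (N n) K) => //.
  - near: n; apply: (big (fun y => 2 * y <= expR (eps / 4 * y))).
    by apply: near_linear_le_expR; rewrite divr_gt0.
  - near: n; apply: (big (fun y => 32 * y <= expR (a / 4 * y))).
    by apply: near_linear_le_expR; rewrite divr_gt0.
  - near: n; apply: (big (fun y => 16 * K%:R <= expR (eps / 2 * y))).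
    by apply: near_cst_le_expR; rewrite divr_gt0.
  - rewrite [x n / 2]mulrC; near: n.
    by apply: (big (fun y => 32 <= expR (2^-1 * y))); apply: near_cst_le_expR.
have L0 : 0 < L by have := expR_ge1Dx (- L); rewrite -qE; lra.
have s0 : (0 < s)%N by apply: ltnW.
have al0 : 0 < alpha.
  have : 0 < (1 + 2 * a) * alpha by apply: lt_le_trans hd; rewrite ltr0n.
  by rewrite pmulr_rgt0 //; lra.
have cV : #|blowup_vertex (nn n)| = N n by apply: card_blowup_vertex.
have YE : ln (1 / (1 - p n)) / (2 * ln (p n * #|blowup_vertex (nn n)|%:R)) = alpha^-1.
  by rewrite cV -/L -/P /alpha invf_div.
have Nchi : (N n <= k * chi (blowup H (nn n)))%N by apply: l1norm_le_chi.
have [] := andP (@percolation_chi_prob_ge R k H (nn n) (p n) p01 d s m D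
  (fun Gp => let Y := ln (1 / (1 - p n)) / (2 * ln (p n * #|blowup_vertex (nn n)|%:R))
               * (chi (blowup H (nn n)))%:R in
    (1 - delta) * Y <= (chi Gp)%:R <= (1 + delta) * Y) s0 _).
  move=> F h1 h2; rewrite /= YE.
  exact: (@chi_window R a delta alpha (N n) k _ _ d s D).
set prob := percolation_prob _ _ _ => lo hi.
have eA := dense_independent_prob (blowup H (nn n)) p01 d0; rewrite cV in eA.
have eB := dense_small_prob (blowup H (nn n)) p01 D0 hDm; rewrite cV in eB.
have eC := poor_clique_prob (blowup H (nn n)) p01 s2 sm; rewrite cV in eC.
have h2 : e0 / 2 <= 2^-1 by lra.
have {}eA := eA (le_trans hdA h2).
have {}eB := eB (le_trans hDA h2).
rewrite ger0_norm ?subr_ge0 //.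
(* Each of the three failure probabilities is at most [e0], and 3 e0 <= e. *)
move: lo eA eB eC hdA hDA hsA e0e.
generalize (expect (p n) (edges (blowup H (nn n)))
  (fun F => (dense_independent (blowup H (nn n)) d F)%:R)) => t1.
generalize (expect (p n) (edges (blowup H (nn n)))
  (fun F => (dense_small (blowup H (nn n)) m D F)%:R)) => t2.
generalize (expect (p n) (edges (blowup H (nn n)))
  (fun F => (poor_clique (blowup H (nn n)) m s F)%:R)) => t3.
generalize (expR 1 * ((N n)%:R / d%:R) * Num.sqrt (1 - p n) ^+ d) => t4.
generalize (expR 1 * (N n)%:R * 2^-1 ^+ D : R) => t5.
generalize (2 ^+ N n * expR (- (4 * overlap (p n) m s)^-1)) => t6.
clearbody prob; clear.
move=> *; lra.
Unshelve. all: by end_near. Qed.
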